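(* Assume $N\geq 2d+1$. Then there exists a unique invariant measure $\pi=\pi\mathcal T\in\mathcal P_{\mathcal U}(\mathcal S_d^0)$ of the Markov transition $\mathcal T$ of the Ensemble Kalman filter sample covariances. In addition, there exist parameters $a,b>0$ such that for any $n\geq 1$ and any $\mu_1,\mu_2\in\mathcal P_{\mathcal U}(\mathcal S_d^0)$, $$\Vert \mu_1\mathcal T_n-\mu_2\mathcal T_n\Vert_{\mathcal U}\leq a\,e^{-bn}\,\Vert\mu_1-\mu_2\Vert_{\mathcal U}$$ and, for the total variation norm, $$\Vert \mu_1\mathcal T_n-\mu_2\mathcal T_n\Vert_{\rm tv}\leq a\,e^{-bn}\,\Vert\mu_1-\mu_2\Vert_{\rm tv}.$$
   Context: $M'$ is the transpose, $I$ the identity. $\mathcal S_d^0$ is the cone of symmetric positive semi-definite $d\times d$ real matrices. Fix $d,d_0\ge1$, $A\in\mathbb{R}^{d\times d}$, $B\in\mathbb{R}^{d_0\times d}$, symmetric positive definite $R\in\mathbb{R}^{d\times d}$, $R_0\in\mathbb{R}^{d_0\times d_0}$, and put $S:=B'R_0^{-1}B$, assumed positive definite. For $P\in\mathcal S_d^0$ set $K(P):=PB'(BPB'+R_0)^{-1}$, $\widehat A(P):=I-K(P)B=(I+PS)^{-1}$, $\widehat R(P):=K(P)R_0K(P)'$. Non-central Wishart law: for $z\in\mathbb{R}^{d\times N}$ and $\Sigma\in\mathcal S_d^0$, $\mathrm{Wishart}_d(N,zz',\Sigma)$ is the law of $(z+Z)(z+Z)'$, where $Z$ is a $d\times N$ random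 matrix with independent $\mathcal N_d(0,\Sigma)$ columns (it depends on $z$ only through $zz'$); $\frac1N\mathrm{Wishart}_d(\cdot)$ is the law of $M/N$ with $M\sim\mathrm{Wishart}_d(\cdot)$. The Markov transition $\mathcal T(p,dq)=\mathbb P(p_{n+1}\in dq\mid p_n=p)$ of the sample covariances of the Ensemble Kalman filter with $N+1$ particles is the law of $q$ obtained from $p$ in two steps: first $\widehat p\sim\frac1N\mathrm{Wishart}_d(N,N\widehat A(p)p\widehat A(p)',\widehat R(p))$, and then, given $\widehat p$, $q\sim\frac1N\mathrm{Wishart}_d(N,NA\widehat pA',R)$. $\mathcal T_n$ is the $n$-fold composition of $\mathcal T$, and $(\mu\mathcal T)(dq)=\int\mu(dp)\mathcal T(p,dq)$. $\mathcal U(p):=1+\mathrm{Tr}(p)+\mathrm{Tr}(p^{-1})$ on $\mathcal S_d^0$ (equal to $+\infty$ for singular $p$). $\mathcal P_{\mathcal U}(\mathcal S_d^0)$ is the set of probability measures $\mu$ on $\mathcal S_d^0$ with $\mu(\mathcal U)<\infty$. For a function $f:\mathcal S_d^0\to\mathbb R$, $\|f\|_{\mathcal U}:=\sup_p|f(p)/\mathcal U(p)|$; for a signed measure $\mu$, $\|\mu\|_{\mathcal U}:=\sup\{|\mu(f)|:\|f\|_{\mathcal U}\le1\}$. $\|\cdot\|_{\rm tv}$ is the total variation norm. *)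

(* Defs.v *)
From HB Require Import structures.
From mathcomp Require Import all_boot all_order all_algebra.
From mathcomp Require Import all_classical all_reals all_analysis.
From mathcomp Require Import measurable_realfun.

Set Implicit Arguments.
Unset Strict Implicit.
Unset Printing Implicit Defensive.
Import Order.TTheory GRing.Theory Num.Theory.
Import numFieldNormedType.Exports.
Local Open Scope classical_set_scope.
Local Open Scope ring_scope.

Section definiteness.
Context {R : realType} {d : nat}.
Implicit Types P : 'M[R]_d.

Definition psdmx P :=
  P^T = P /\ forall v : 'rV[R]_d, 0 <= (v *m P *m v^T) 0 0.

Definition posdefmx P :=
  P^T = P /\ forall v : 'rV[R]_d, v != 0 -> 0 < (v *m P *m v^T) 0 0.

End definiteness.

Section psd_gram.
Context {R : realType}.

Lemma normrow_ge0 n (v : 'rV[R]_n) : 0 <= (v *m v^T) 0 0.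
Proof. by rewrite mxE sumr_ge0// => i _; rewrite mxE -expr2 sqr_ge0. Qed.

Lemma psdmx_gram m n (Y : 'M[R]_(m, n)) : psdmx (Y *m Y^T).
Proof.
split; first by rewrite trmx_mul trmxK.
by move=> v; rewrite mulmxA -mulmxA -trmx_mul normrow_ge0.
Qed.

Lemma psdmx0 n : psdmx (0 : 'M[R]_n).
Proof. by split=> [|v]; rewrite ?trmx0// mulmx0 mul0mx mxE. Qed.

Lemma psdmxZ n (c : R) (P : 'M[R]_n) : 0 <= c -> psdmx P -> psdmx (c *: P).
Proof.
move=> c0 [PT P0]; split=> [|v]; first by rewrite linearZ/= PT.
by rewrite -scalemxAr -scalemxAl mxE mulr_ge0.
Qed.

End psd_gram.

(* The cone of symmetric positive semi-definite matrices. Its sigma-algebra is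
   generated by the matrix entries; this is the Borel sigma-algebra. *)
Record psd (R : realType) (d : nat) :=
  Psd { psd_mx :> 'M[R]_d ; psd_mxP : psdmx psd_mx }.

Lemma psd_inj (R : realType) d : injective (@psd_mx R d).
Proof.
move=> [p hp] [q hq] /= pq; subst q; congr Psd; exact: Prop_irrelevance.
Qed.

HB.instance Definition _ (R : realType) d := gen_eqMixin (psd R d).
HB.instance Definition _ (R : realType) d := gen_choiceMixin (psd R d).
HB.instance Definition _ (R : realType) d :=
  isPointed.Build (psd R d) (Psd (psdmx0 d)).

Definition psd_display : measure_display.
Proof. by constructor. Qed.

Section psd_measurable.
Context {R : realType} {d : nat}.

Definition psd_entry (ij : 'I_d * 'I_d) (p : psd R d) : measurableTypeR R :=
  psd_mx p ij.1 ij.2.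

Definition psd_generators : set (set (psd R d)) :=
  \bigcup_(ij in [set: 'I_d * 'I_d])
    preimage_set_system setT (psd_entry ij) measurable.

Let psd_set0 : <<s psd_generators >> set0.
Proof. exact: sigma_algebra0. Qed.

Let psd_setC A : <<s psd_generators >> A -> <<s psd_generators >> (~` A).
Proof. exact: sigma_algebraC. Qed.

Let psd_bigcup (F : (set (psd R d))^nat) :
  (forall i, <<s psd_generators >> (F i)) ->
  <<s psd_generators >> (\bigcup_i F i).
Proof. exact: sigma_algebra_bigcup. Qed.

HB.instance Definition _ := @isMeasurable.Build psd_display (psd R d)
  <<s psd_generators >> psd_set0 psd_setC psd_bigcup.

End psd_measurable.

Section cholesky.
Context {R : realType}.

(* Since 0^-1 = 0, the same recursion works for singular matrices. *)
Fixpoint chol (d : nat) : 'M[R]_d -> 'M[R]_d :=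
  match d with
  | 0 => fun p => p
  | d'.+1 => fun p : 'M[R]_(1 + d') =>
      block_mx (Num.sqrt (p 0 0))%:M 0
        ((Num.sqrt (p 0 0))^-1 *: dlsubmx p)
        (chol (drsubmx p - (p 0 0)^-1 *: (dlsubmx p *m (dlsubmx p)^T)))
  end.

End cholesky.

Section cholesky_correct.
Context {R : realType}.

Lemma psdmx_block (n : nat) (p : 'M[R]_(1 + n)) (x : R) (v : 'rV[R]_n) :
  psdmx p ->
  0 <= x * p 0 0 * x + (x * (v *m dlsubmx p) 0 0) *+ 2
       + (v *m drsubmx p *m v^T) 0 0.
Proof.
move=> [pT p0]; have := p0 (row_mx x%:M v).
rewrite -[X in row_mx _ _ *m X *m _]submxK mul_row_block tr_row_mx mul_row_col.
have ur : ursubmx p = (dlsubmx p)^T by rewrite trmx_dlsub pT.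
have ul : ulsubmx p = (p 0 0)%:M.
  by rewrite [LHS]mx11_scalar; congr (_%:M); rewrite !mxE; congr (p _ _); apply/val_inj.
rewrite ur ul tr_scalar_mx !mul_mx_scalar !mul_scalar_mx !mulmxDl -!scalemxAl.
set s := v *m dlsubmx p.
have sT : (dlsubmx p)^T *m v^T = s by rewrite -trmx_mul -/s {1}[s]mx11_scalar tr_scalar_mx -mx11_scalar.
rewrite sT scalerDr !mxE eqxx mulr1n mulr2n.
by rewrite -!addrA -mulrA.
Qed.

Lemma psdmx_corner_ge0 (n : nat) (p : 'M[R]_(1 + n)) : psdmx p -> 0 <= p 0 0.
Proof.
move=> /(psdmx_block 1 0).
by rewrite !mul0mx !mxE mulr0 mul0rn !addr0 mulr1 mul1r.
Qed.

Lemma psdmx_corner_eq0 (n : nat) (p : 'M[R]_(1 + n)) :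
  psdmx p -> p 0 0 = 0 -> dlsubmx p = 0.
Proof.
move=> hp a0; apply/matrixP => i j; rewrite (ord1 j) [RHS]mxE.
apply/eqP/negPn/negP => b0.
pose v : 'rV[R]_n := delta_mx 0 i.
have vb : (v *m dlsubmx p) 0 0 = dlsubmx p i 0 by rewrite -rowE mxE.
set c := (v *m drsubmx p *m v^T) 0 0.
set b := dlsubmx p i 0 in b0 vb *.
have := psdmx_block (- (c + 1) / (b *+ 2)) v hp.
rewrite a0 vb -/c mulr0 mul0r add0r -mulrnAr divfK ?mulrn_eq0//.
by rewrite opprD addrAC addNr add0r oppr_ge0 ler10.
Qed.

Lemma psdmx_schur (n : nat) (p : 'M[R]_(1 + n)) : psdmx p ->
  psdmx (drsubmx p - (p 0 0)^-1 *: (dlsubmx p *m (dlsubmx p)^T)).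
Proof.
move=> hp; have pT := hp.1; split.
  by rewrite linearB linearZ/= trmx_mul trmxK trmx_drsub pT.
move=> v; set b := (v *m dlsubmx p) 0 0.
have := psdmx_block (- b / p 0 0) v hp.
rewrite mulmxBr mulmxBl -scalemxAr -scalemxAl.
set c := v *m drsubmx p *m v^T.
have -> : v *m (dlsubmx p *m (dlsubmx p)^T) *m v^T = (b * b)%:M.
  rewrite mulmxA -mulmxA -trmx_mul.
  by rewrite [v *m dlsubmx p]mx11_scalar tr_scalar_mx -scalar_mxM.
rewrite !mxE eqxx mulr1n -/b.
have [a0|a0] := eqVneq (p 0 0) 0.
  by rewrite a0 invr0 !(mulr0,mul0r) mul0rn !add0r subr0.
rewrite divfK// mulr2n; set a := p 0 0.
rewrite [\sum_j v 0 j * _ j 0](_ : _ = b); last by rewrite /b [RHS]mxE.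
congr (0 <= _); rewrite addrC; congr (_ + _).
rewrite mulrA mulrNN !mulNr [_ / a * b]mulrAC mulrC.
by rewrite addrA subrr sub0r mulrC.
Qed.

Lemma cholP (d : nat) (p : 'M[R]_d) : psdmx p -> chol p *m (chol p)^T = p.
Proof.
elim: d p => [p _|d ih p hp]; first by apply/matrixP => -[].
have p0 := psdmx_corner_ge0 hp.
rewrite /= (@tr_block_mx _ 1 d 1 d) (@mulmx_block _ 1 d 1 d 1 d).
rewrite !trmx0 !mulmx0 !mul0mx !addr0 tr_scalar_mx -scalar_mxM -expr2 sqr_sqrtr//.
rewrite ih; last exact: psdmx_schur.
rewrite mul_mx_scalar mul_scalar_mx linearZ/= -scalemxAl -scalemxAr !scalerA.
rewrite -[RHS](@submxK _ 1 d 1 d).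
have ul : ulsubmx (p : 'M[R]_(1 + d)) = (p 0 0)%:M.
  by rewrite [LHS]mx11_scalar; congr (_%:M); rewrite !mxE; congr (p _ _); apply/val_inj.
have ur : ursubmx (p : 'M[R]_(1 + d)) = (dlsubmx (p : 'M[R]_(1 + d)))^T.
  by rewrite trmx_dlsub hp.1.
have e : Num.sqrt (p 0 0) / Num.sqrt (p 0 0) *: dlsubmx (p : 'M[R]_(1 + d)) =
         dlsubmx (p : 'M[R]_(1 + d)).
  have [a0|a0] := eqVneq (p 0 0) 0.
    by rewrite (psdmx_corner_eq0 hp a0) scaler0.
  by rewrite divff ?scale1r// sqrtr_eq0 -ltNge lt_neqAle eq_sym a0.
have eT : Num.sqrt (p 0 0) / Num.sqrt (p 0 0) *: (dlsubmx (p : 'M[R]_(1 + d)))^T =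
          (dlsubmx (p : 'M[R]_(1 + d)))^T by rewrite -linearZ/= e.
rewrite ul ur e eT -invfM -expr2 sqr_sqrtr//.
by rewrite [_ *: _ + _]addrC subrK.
Qed.

End cholesky_correct.

(* A matrix-valued function is handled through its entries. *)
Section measurable_matrix.
Context {R : realType} {dX : measure_display} {X : measurableType dX}.

Definition measurable_mx m n (f : X -> 'M[R]_(m, n)) : Prop :=
  forall i j, measurable_fun [set: X] (fun x => f x i j : measurableTypeR R).

Lemma measurable_fun_inv (f : X -> R) :
  measurable_fun [set: X] (f : X -> measurableTypeR R) ->
  measurable_fun [set: X] ((fun x => (f x)^-1) : X -> measurableTypeR R).
Proof.
move=> mf; apply: (@measurableT_comp _ _ _ _ _ _ (@GRing.inv R)) => //.
rewrite -(setUv [set (0 : R)]).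
apply/measurable_funU; [exact: measurable_set1|apply: measurableC; exact: measurable_set1|].
split; first exact: measurable_fun_set1.
apply: open_continuous_measurable_fun.
  by apply: closed_openC; apply: accessible_closed_set1; apply: hausdorff_accessible; exact: Rhausdorff.
by move=> x; rewrite inE/= => /eqP x0; exact: inv_continuous.
Qed.

Lemma measurable_mx_cst m n (M : 'M[R]_(m, n)) : measurable_mx (fun=> M).
Proof. by move=> i j; exact: measurable_cst. Qed.

Lemma measurable_mxT m n (f : X -> 'M[R]_(m, n)) :
  measurable_mx f -> measurable_mx (fun x => (f x)^T).
Proof. by move=> mf i j; under eq_fun do rewrite mxE; exact: mf. Qed.

Lemma measurable_mxD m n (f g : X -> 'M[R]_(m, n)) :
  measurable_mx f -> measurable_mx g -> measurable_mx (fun x => f x + g x).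
Proof.
by move=> mf mg i j; under eq_fun do rewrite mxE; apply: measurable_funD;
  [exact: mf|exact: mg].
Qed.

Lemma measurable_mxZ m n (c : X -> R) (f : X -> 'M[R]_(m, n)) :
  measurable_fun [set: X] (c : X -> measurableTypeR R) -> measurable_mx f ->
  measurable_mx (fun x => c x *: f x).
Proof.
by move=> mc mf i j; under eq_fun do rewrite mxE; apply: measurable_funM;
  [exact: mc|exact: mf].
Qed.

Lemma measurable_mxB m n (f g : X -> 'M[R]_(m, n)) :
  measurable_mx f -> measurable_mx g -> measurable_mx (fun x => f x - g x).
Proof.
by move=> mf mg i j; under eq_fun do rewrite !mxE; apply: measurable_funB;
  [exact: mf|exact: mg].
Qed.

Lemma measurable_mxM m n k (f : X -> 'M[R]_(m, n)) (g : X -> 'M[R]_(n, k)) :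
  measurable_mx f -> measurable_mx g -> measurable_mx (fun x => f x *m g x).
Proof.
move=> mf mg i j; under eq_fun do rewrite mxE.
by apply: measurable_sum => l; apply: measurable_funM; [exact: mf|exact: mg].
Qed.

Lemma measurable_mx_scalar n (c : X -> R) :
  measurable_fun [set: X] (c : X -> measurableTypeR R) ->
  measurable_mx (fun x => (c x)%:M : 'M[R]_n).
Proof.
move=> mc i j; under eq_fun do rewrite mxE.
by case: (i == j) => //; exact: measurable_cst.
Qed.

Lemma measurable_mxsub m n k l (r : 'I_k -> 'I_m) (s : 'I_l -> 'I_n)
    (f : X -> 'M[R]_(m, n)) :
  measurable_mx f -> measurable_mx (fun x => mxsub r s (f x)).
Proof. by move=> mf i j; under eq_fun do rewrite mxE; exact: mf. Qed.

Lemma measurable_block_mx m1 m2 n1 n2 (f : X -> 'M[R]_(m1, n1))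
    (g : X -> 'M[R]_(m1, n2)) (h : X -> 'M[R]_(m2, n1))
    (k : X -> 'M[R]_(m2, n2)) :
  measurable_mx f -> measurable_mx g -> measurable_mx h -> measurable_mx k ->
  measurable_mx (fun x => block_mx (f x) (g x) (h x) (k x)).
Proof.
move=> mf mg mh mk i j.
rewrite -(splitK i) -(splitK j).
case: (fintype.split i) => i'; case: (fintype.split j) => j' /=.
- by under eq_fun do rewrite block_mxEul; exact: mf.
- by under eq_fun do rewrite block_mxEur; exact: mg.
- by under eq_fun do rewrite block_mxEdl; exact: mh.
- by under eq_fun do rewrite block_mxEdr; exact: mk.
Qed.

Lemma measurable_det n (f : X -> 'M[R]_n) : measurable_mx f ->
  measurable_fun [set: X] ((fun x => \det (f x)) : X -> measurableTypeR R).
Proof.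
move=> mf; rewrite /determinant; apply: measurable_sum => s.
apply: measurable_funM; first exact: measurable_cst.
by apply: measurable_prod => i _; exact: mf.
Qed.

Lemma measurable_invmx n (f : X -> 'M[R]_n) : measurable_mx f ->
  measurable_mx (fun x => invmx (f x)).
Proof.
move=> mf i j.
rewrite (_ : (fun x => _) = fun x => if \det (f x) == 0 then f x i j
  else (\det (f x))^-1 * (\adj (f x)) i j); last first.
  apply/funext => x; rewrite /invmx unitmxE unitfE.
  by case: eqP => //=; rewrite mxE.
have mdet := measurable_det mf.
apply: measurable_fun_ifT.
- by apply: measurable_fun_eqr => //; exact: measurable_cst.
- exact: mf.
apply: measurable_funM; first exact: measurable_fun_inv.
under eq_fun do rewrite mxE /cofactor.
apply: measurable_funM; first exact: measurable_cst.
apply: measurable_det => k l; under eq_fun do rewrite !mxE.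
exact: mf.
Qed.

Lemma measurable_chol n (f : X -> 'M[R]_n) : measurable_mx f ->
  measurable_mx (fun x => chol (f x)).
Proof.
elim: n f => [//|n ih f mf] /=.
have ms : measurable_fun [set: X]
    ((fun x => Num.sqrt (f x 0 0)) : X -> measurableTypeR R).
  apply: (@measurableT_comp _ _ _ _ _ _ (@Num.sqrt R)); last exact: mf.
  by apply: continuous_measurable_fun => x; exact: sqrt_continuous.
have mdl : measurable_mx (fun x => dlsubmx (f x : 'M[R]_(1 + n))).
  by move=> i j; under eq_fun do rewrite !mxE; exact: mf.
apply: (@measurable_block_mx 1 n 1 n).
- exact: measurable_mx_scalar.
- exact: measurable_mx_cst.
- by apply: measurable_mxZ => //; exact: measurable_fun_inv.
apply: ih; apply: measurable_mxB.
  by move=> i j; under eq_fun do rewrite !mxE; exact: mf.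
apply: measurable_mxZ; first by apply: measurable_fun_inv; exact: mf.
by apply: measurable_mxM => //; exact: measurable_mxT.
Qed.

Lemma measurable_psd n (f : X -> psd R n) :
  measurable_mx (fun x => psd_mx (f x)) -> measurable_fun [set: X] f.
Proof.
move=> mf; apply: (measurability (@psd_generators R n)) => //.
move=> _ [_ [ij _ [A mA <-]] <-].
rewrite !setTI.
by have := mf ij.1 ij.2 measurableT A mA; rewrite setTI.
Qed.

End measurable_matrix.

Lemma measurable_psd_mx (R : realType) n : measurable_mx (@psd_mx R n).
Proof.
move=> i j _ A mA; rewrite setTI; apply: sub_sigma_algebra.
by exists (i, j) => //; exists A => //; rewrite setTI.
Qed.
Section iid_law.
Context {R : realType} {dT : measure_display} {T : measurableType dT}.

Definition prob_prod {dU} {U : measurableType dU} (P : probability T R)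
  (Q : probability U R) : set (T * U) -> \bar R := (P \x Q)%E.

Section prob_prod_instance.
Context {dU} {U : measurableType dU} (P : probability T R) (Q : probability U R).

HB.instance Definition _ := Measure.on (prob_prod P Q).

Let prob_prod_setT : prob_prod P Q setT = 1%E.
Proof.
rewrite /prob_prod -setXTT product_measure1E//.
by rewrite [X in (X * _)%E](probability_setT P) mul1e; exact: probability_setT.
Qed.

HB.instance Definition _ :=
  Measure_isProbability.Build _ _ _ (prob_prod P Q) prob_prod_setT.

End prob_prod_instance.

Definition tuple_cons n (xw : T * n.-tuple T) : n.+1.-tuple T :=
  [the n.+1.-tuple T of xw.1 :: xw.2].

Let measurable_tuple_cons n : measurable_fun [set: _] (@tuple_cons n).
Proof. exact: measurable_cons. Qed.

HB.instance Definition _ n :=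
  isMeasurableFun.Build _ _ _ _ (@tuple_cons n) (@measurable_tuple_cons n).

Fixpoint iid (P : probability T R) (n : nat) : probability (n.-tuple T) R :=
  match n with
  | 0 => \d_[tuple]
  | n'.+1 => distribution (prob_prod P (iid P n')) (@tuple_cons n')
  end.

End iid_law.

Section wishart.
Context {R : realType} {d : nat} (N : nat).

(* Under the law iid (normal_prob 0 1) (d * N) of w, the entries of gauss_mx w
   are independent standard normal variables. *)
Definition gauss_mx (w : (d * N).-tuple (measurableTypeR R)) : 'M[R]_(d, N) :=
  vec_mx (\row_k tnth w k).

Definition noise_law := iid (normal_prob (0 : R) 1) (d * N).

(* A d x N matrix z such that z z' = Om, for Om positive semi-definite and
   d <= N. *)
Definition mean_mx (Om : 'M[R]_d) : 'M[R]_(d, N) := chol Om *m pid_mx d.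

Lemma mean_mxP (Om : 'M[R]_d) : (d <= N)%N -> psdmx Om ->
  mean_mx Om *m (mean_mx Om)^T = Om.
Proof.
move=> dN hOm; rewrite /mean_mx trmx_mul mulmxA -(mulmxA (chol Om)) tr_pid_mx.
by rewrite mul_pid_mx minnn (minn_idPr dN) pid_mx_1 mulmx1 cholP.
Qed.

(* As Sg = chol Sg *m (chol Sg)^T, the columns of chol Sg *m gauss_mx w are
   independent with law N_d(0, Sg). *)
Definition wishart_mx (Om Sg : 'M[R]_d) w : psd R d :=
  Psd (psdmx_gram (mean_mx Om + chol Sg *m gauss_mx w)).

Lemma measurable_wishart_mx dX (X : measurableType dX) (Om Sg : X -> 'M[R]_d) :
  measurable_mx Om -> measurable_mx Sg ->
  measurable_fun [set: X * _] (fun xw => wishart_mx (Om xw.1) (Sg xw.1) xw.2).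
Proof.
move=> mOm mSg; apply: measurable_psd => /=.
set Y := fun xw : X * _ => mean_mx (Om xw.1) + chol (Sg xw.1) *m gauss_mx xw.2.
suff mY : measurable_mx Y by apply: measurable_mxM => //; exact: measurable_mxT.
have fstP n m (f : X -> 'M[R]_(n, m)) : measurable_mx f ->
    measurable_mx (fun xw : X * (d * N).-tuple (measurableTypeR R) => f xw.1).
  move=> mf i j.
  apply: (@measurableT_comp _ _ _ _ _ _ (fun x => f x i j)); first exact: mf.
  exact: measurable_fst.
apply: measurable_mxD.
  apply: (fstP _ _ (fun x => mean_mx (Om x))).
  apply: measurable_mxM; first exact: measurable_chol.
  exact: measurable_mx_cst.
apply: measurable_mxM; first 
  by apply: (fstP _ _ (fun x => chol (Sg x))); exact: measurable_chol.
move=> i j; under eq_fun do rewrite !mxE.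
apply: (@measurableT_comp _ _ _ _ _ _
  (fun w : (d * N).-tuple (measurableTypeR R) => tnth w (mxvec_index i j))).
  exact: measurable_tnth.
exact: measurable_snd.
Qed.

Let measurable_wishart_mx1 (Om Sg : 'M[R]_d) :
  measurable_fun [set: _] (wishart_mx Om Sg).
Proof.
have mF := @measurable_wishart_mx _ unit (fun=> Om) (fun=> Sg)
  (measurable_mx_cst _) (measurable_mx_cst _).
exact: (measurableT_comp mF (pair1_measurable tt)).
Qed.

HB.instance Definition _ (Om Sg : 'M[R]_d) :=
  isMeasurableFun.Build _ _ _ _ (wishart_mx Om Sg) (measurable_wishart_mx1 Om Sg).

(* Wishart_d(N, Om, Sg), Om standing for the product zz'. *)
Definition wishart (Om Sg : 'M[R]_d) : probability (psd R d) R :=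
  distribution noise_law (wishart_mx Om Sg).

Definition psd_divN (p : psd R d) : psd R d :=
  Psd (psdmxZ (n := d) (c := N%:R^-1)
    (etrans (invr_ge0 _) (ler0n R N)) (psd_mxP p)).

Let measurable_psd_divN : measurable_fun [set: psd R d] psd_divN.
Proof.
apply: measurable_psd; apply: measurable_mxZ; first exact: measurable_cst.
exact: measurable_psd_mx.
Qed.

HB.instance Definition _ :=
  isMeasurableFun.Build _ _ _ _ psd_divN measurable_psd_divN.

Definition scaled_wishart (Om Sg : 'M[R]_d) : probability (psd R d) R :=
  distribution (wishart Om Sg) psd_divN.

Section wishart_kernel.
Context {dX : measure_display} {X : measurableType dX} (Om Sg : X -> 'M[R]_d).

Definition wishart_kernel of measurable_mx Om & measurable_mx Sg :
    X -> {measure set (psd R d) -> \bar R} :=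
  fun x => scaled_wishart (Om x) (Sg x).

Variables (mOm : measurable_mx Om) (mSg : measurable_mx Sg).

Let measurable_wishart_kernel U : measurable U ->
  measurable_fun [set: X] (wishart_kernel mOm mSg ^~ U).
Proof.
move=> mU.
pose F (xw : X * (d * N).-tuple (measurableTypeR R)) :=
  psd_divN (wishart_mx (Om xw.1) (Sg xw.1) xw.2).
have mF : measurable_fun [set: _] F.
  by apply: (measurableT_comp measurable_psd_divN); exact: measurable_wishart_mx.
have mFU : measurable (F @^-1` U) by rewrite -[X in measurable X]setTI; exact: mF.
rewrite [X in measurable_fun _ X](_ : _ = noise_law \o xsection (F @^-1` U)).
  exact: measurable_fun_xsection.
apply/funext => x /=; rewrite /wishart_kernel /scaled_wishart /wishart.
rewrite /distribution /pushforward /=; congr (noise_law _).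
by apply/seteqP; split => w; rewrite /xsection/= inE.
Qed.

HB.instance Definition _ := isKernel.Build _ _ _ _ _
  (wishart_kernel mOm mSg) measurable_wishart_kernel.

Let wishart_kernel_setT x : wishart_kernel mOm mSg x setT = 1%E.
Proof. exact: probability_setT. Qed.

HB.instance Definition _ := Kernel_isProbability.Build _ _ _ _ _
  (wishart_kernel mOm mSg) wishart_kernel_setT.

End wishart_kernel.

End wishart.

Section markov.
Context {R : realType} {dX : measure_display} {X : measurableType dX}.
Local Open Scope ereal_scope.

Section composition.
Variables k1 k2 : R.-pker X ~> X.

Definition markov_comp : X -> {measure set X -> \bar R} := mkcomp_noparam k1 k2.

HB.instance Definition _ := Kernel.on markov_comp.

Let markov_comp_setT x : markov_comp x setT = 1.
Proof.
rewrite /markov_comp /mkcomp_noparam /= /kcomp_noparam.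
under eq_integral do rewrite prob_kernel.
by rewrite integral_cst// mul1e prob_kernel.
Qed.

HB.instance Definition _ := Kernel_isProbability.Build _ _ _ _ _
  markov_comp markov_comp_setT.

End composition.

Fixpoint markov_iter (k : R.-pker X ~> X) (n : nat) : R.-pker X ~> X :=
  match n with
  | 0 => kdirac (@measurable_id _ X setT)
  | n'.+1 => markov_comp (markov_iter k n') k
  end.

Section action.
Variables (mu : probability X R) (k : R.-pker X ~> X).

Definition markov_act (U : set X) : \bar R := \int[mu]_x k x U.

Let markov_act0 : markov_act set0 = 0.
Proof. by apply: integral0_eq => x _; rewrite measure0. Qed.

Let markov_act_ge0 U : 0 <= markov_act U.
Proof. by apply: integral_ge0 => x _; exact: measure_ge0. Qed.

Let markov_act_sigma_additive : semi_sigma_additive markov_act.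
Proof.
move=> F mF tF mUF; rewrite /markov_act.
rewrite (_ : (fun n => _) = (fun n => \sum_(0 <= i < n) \int[mu]_x k x (F i)))//.
rewrite (_ : \int[mu]_x _ = \sum_(i <oo) \int[mu]_x k x (F i)).
  by apply: is_cvg_ereal_nneg_natsum => i _; apply: integral_ge0.
rewrite -integral_nneseries//; last by move=> n; exact: measurable_kernel.
apply: eq_integral => x _; apply/esym/cvg_lim => //.
exact: measure_semi_sigma_additive.
Qed.

HB.instance Definition _ := isMeasure.Build _ _ _ markov_act
  markov_act0 markov_act_ge0 markov_act_sigma_additive.

Let markov_act_setT : markov_act setT = 1.
Proof.
rewrite /markov_act; under eq_integral do rewrite prob_kernel.
by rewrite integral_cst// mul1e; exact: probability_setT.
Qed.

HB.instance Definition _ := Measure_isProbability.Build _ _ _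
  markov_act markov_act_setT.

End action.

Definition is_invariant (k : R.-pker X ~> X) (mu : probability X R) : Prop :=
  forall U, measurable U -> markov_act mu k U = mu U.

End markov.

Section norms.
Context {R : realType} {dX : measure_display} {X : measurableType dX}.
Local Open Scope ereal_scope.

Definition signed_diff (mu1 mu2 : probability X R) : {charge set X -> \bar R} :=
  cadd (charge_of_finite_measure mu1) (copp (charge_of_finite_measure mu2)).

Section signed_measure.
Variable nu : {charge set X -> \bar R}.

Let posset := sval (cid (Hahn_decomposition nu)).
Let negset := sval (cid (svalP (cid (Hahn_decomposition nu)))).
Let nuPN : hahn_decomposition nu posset negset :=
  svalP (cid (svalP (cid (Hahn_decomposition nu)))).

Definition signed_integral (f : X -> R) : \bar R :=
  \int[jordan_pos nuPN]_x (f x)%:E - \int[jordan_neg nuPN]_x (f x)%:E.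

Definition tv_norm : \bar R := charge_variation nuPN [set: X].

(* x / +oo = 0, so W p = +oo puts no constraint on f p. *)
Definition fun_wnorm (W : X -> \bar R) (f : X -> R) : \bar R :=
  ereal_sup [set `|(f x)%:E / W x| | x in [set: X]].

Definition wnorm (W : X -> \bar R) : \bar R :=
  ereal_sup [set `|signed_integral f| | f in
    [set f : X -> R | measurable_fun [set: X] (f : X -> measurableTypeR R)
                      /\ fun_wnorm W f <= 1]].

End signed_measure.
End norms.

(* R is the field of real numbers; R1 and R0 are the covariance matrices of the
   signal and observation noises. *)
Section enkf.
Context {R : realType} {d d0 : nat}.
Variables (A : 'M[R]_d) (B : 'M[R]_(d0, d)) (R1 : 'M[R]_d) (R0 : 'M[R]_d0).
Variable N : nat.

Definition gain (P : 'M[R]_d) : 'M[R]_(d, d0) :=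
  P *m B^T *m invmx (B *m P *m B^T + R0).

Definition Ahat (P : 'M[R]_d) : 'M[R]_d := 1%:M - gain P *m B.

Definition Rhat (P : 'M[R]_d) : 'M[R]_d := gain P *m R0 *m (gain P)^T.

Definition update_mean (p : psd R d) : 'M[R]_d :=
  N%:R *: (Ahat p *m p *m (Ahat p)^T).

Definition update_cov (p : psd R d) : 'M[R]_d := Rhat p.

Definition predict_mean (p : psd R d) : 'M[R]_d := N%:R *: (A *m p *m A^T).

Definition predict_cov (p : psd R d) : 'M[R]_d := R1.

Lemma measurable_gain : measurable_mx (fun p : psd R d => gain p).
Proof.
apply: measurable_mxM.
  by apply: measurable_mxM; [exact: measurable_psd_mx|exact: measurable_mx_cst].
apply: measurable_invmx; apply: measurable_mxD; last exact: measurable_mx_cst.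
apply: measurable_mxM; last exact: measurable_mx_cst.
by apply: measurable_mxM; [exact: measurable_mx_cst|exact: measurable_psd_mx].
Qed.

Lemma measurable_update_mean : measurable_mx update_mean.
Proof.
have mA : measurable_mx (fun p : psd R d => Ahat p).
  apply: measurable_mxB; first exact: measurable_mx_cst.
  by apply: measurable_mxM; [exact: measurable_gain|exact: measurable_mx_cst].
apply: measurable_mxZ; first exact: measurable_cst.
apply: measurable_mxM; last exact: measurable_mxT.
by apply: measurable_mxM => //; exact: measurable_psd_mx.
Qed.

Lemma measurable_update_cov : measurable_mx update_cov.
Proof.
apply: measurable_mxM; last by apply: measurable_mxT; exact: measurable_gain.
by apply: measurable_mxM; [exact: measurable_gain|exact: measurable_mx_cst].
Qed.

Lemma measurable_predict_mean : measurable_mx predict_mean.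
Proof.
apply: measurable_mxZ; first exact: measurable_cst.
apply: measurable_mxM; last exact: measurable_mx_cst.
by apply: measurable_mxM; [exact: measurable_mx_cst|exact: measurable_psd_mx].
Qed.

Lemma measurable_predict_cov : measurable_mx predict_cov.
Proof. exact: measurable_mx_cst. Qed.

Definition enkf_transition : R.-pker psd R d ~> psd R d :=
  markov_comp
    (wishart_kernel N measurable_update_mean measurable_update_cov)
    (wishart_kernel N measurable_predict_mean measurable_predict_cov).

End enkf.

Section lyapunov.
Context {R : realType} {d : nat}.
Local Open Scope ereal_scope.

Definition lyap (p : psd R d) : \bar R :=
  if psd_mx p \in unitmx then (1 + \tr p + \tr (invmx p))%:E else +oo.

(* The probability measures mu with mu(lyap) < +oo. *)
Definition prob_lyap (mu : probability (psd R d) R) : Prop :=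
  \int[mu]_p lyap p < +oo.

End lyapunov.

(* Main.v *)
From HB Require Import structures.
Require Import Defs.
From mathcomp Require Import all_boot all_order all_algebra.
From mathcomp Require Import all_classical all_reals all_analysis.
From mathcomp Require Import measurable_realfun perm ring lra.

(* The chain is uniformly ergodic. On the one hand E[U(q) | p] is bounded
   uniformly in p: the update step satisfies
   Ahat p Ahat' + Rhat <= S^-1, so that E[Tr phat | p] is bounded, and
   E[Tr q^-1 | phat] is bounded because, by the Cauchy-Binet formula, the
   diagonal entries of the inverse of a Gram matrix (m + Z)(m + Z)' are at most
   a sum of terms 1 / (x^2 + y^2 + z^2), where x, y, z are three independent
   shifted Gaussian variables: this needs d + 2 <= N. On the other hand,
   Tr phat is at most some l with probability at least 1/2, and then the law of
   q has a density bounded below, because the density of N(m, 1) dominates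
   exp(- m^2) / sqrt 2 times that of N(0, 1/2). Doeblin's argument gives a
   contraction in total variation and the invariant measure
   sum_n eps nu Q^n, with Q := T - eps nu; the bound on T(U) carries the
   contraction over to the weighted norm. *)

Set Implicit Arguments.
Unset Strict Implicit.
Unset Printing Implicit Defensive.
Import Order.TTheory GRing.Theory Num.Theory.
Local Open Scope classical_set_scope.
Local Open Scope ring_scope.

(** * Mixtures of kernels *)

(** The delicate point is the inverse moment. For one shifted Gaussian variable E[1 / x^2] is
    infinite, and the shifts attached to x, y, z are themselves random, being ratios built from the
    other entries. The function [spike] decouples the problem: 1 / (x^2 + y^2 + z^2) is at most a
    product of three values of [spike], which are integrated one coordinate at a time with a bound
    valid for every shift, so that the mean matrix disappears. Uniformity in p comes from the
    observation: as S is invertible, the gain can be compared with a left inverse of B, which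
    cancels p. Because E[U(q) | p] is bounded by a constant, the weighted estimate is short: the
    first n - 1 steps contract total mass, the last step turns mass into U-mass, and U >= 1 bounds
    the initial mass by the weighted norm. Differences of measures are written additively, since
    integrals of U may be infinite. *)

Section mixture.
Context {R : realType} {dX dY : measure_display}.
Context {X : measurableType dX} {Y : measurableType dY}.
Local Open Scope ereal_scope.
Variables (mu : {measure set X -> \bar R}) (k : R.-ker X ~> Y).

(** [markov_act] takes a probability, whereas the terms of the invariant series are
    sub-probabilities; any mixing measure is allowed here. *)
Definition mixture (U : set Y) : \bar R := \int[mu]_x k x U.

Let mixture0 : mixture set0 = 0.
Proof. by apply: integral0_eq => x _; rewrite measure0. Qed.

Let mixture_ge0 U : 0 <= mixture U.
Proof. by apply: integral_ge0 => x _; exact: measure_ge0. Qed.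

Let mixture_sigma_additive : semi_sigma_additive mixture.
Proof.
move=> F mF tF mUF.
have -> : mixture (\bigcup_n F n) = \sum_(i <oo) mixture (F i).
  rewrite -integral_nneseries//; last by move=> n; exact: measurable_kernel.
  apply: eq_integral => x _; apply/esym/cvg_lim => //.
  exact: measure_semi_sigma_additive.
by apply: is_cvg_ereal_nneg_natsum => i _; exact: mixture_ge0.
Qed.

HB.instance Definition _ := isMeasure.Build _ _ _ mixture
  mixture0 mixture_ge0 mixture_sigma_additive.

End mixture.

Section integral_mixture.
Context {R : realType} {dX dY : measure_display}.
Context {X : measurableType dX} {Y : measurableType dY}.
Local Open Scope ereal_scope.

Import HBNNSimple.

(** Both sides are linear in f and continuous along increasing limits, so simple functions suffice.
    Asking that nu agree with the mixture on measurable sets only lets one statement serve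
    compositions, invariant measures and laws given by a density. *)
Lemma ge0_integral_mixture (mu : {measure set X -> \bar R})
    (nu : {measure set Y -> \bar R}) (k : R.-ker X ~> Y) (f : Y -> \bar R) :
  (forall U, measurable U -> nu U = \int[mu]_x k x U) ->
  measurable_fun setT f -> (forall y, 0 <= f y) ->
  \int[nu]_y f y = \int[mu]_x \int[k x]_y f y.
Proof.
move=> nuE mf f0.
pose f_ := nnsfun_approx measurableT mf.
have approx (m : {measure set Y -> \bar R}) :
    \int[m]_y f y = limn (fun n => \int[m]_y (f_ n y)%:E).
  rewrite -monotone_convergence//.
  - by apply: eq_integral => y _; apply/esym/cvg_lim => //;
      exact: cvg_nnsfun_approx.
  - by move=> n; exact/measurable_EFinP.
  - by move=> n y _; rewrite lee_fin.
  - by move=> y _ a b ab; rewrite lee_fin; exact/lefP/nd_nnsfun_approx.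
have nd_f m m' (x : Y) : (m <= m')%N -> (f_ m x <= f_ m' x)%R.
  by move=> mm'; exact/lefP/nd_nnsfun_approx.
have simple n : \int[nu]_y (f_ n y)%:E = \int[mu]_x \int[k x]_y (f_ n y)%:E.
  have sumE (m : {measure set Y -> \bar R}) : \int[m]_y (f_ n y)%:E =
      \sum_(r \in range (f_ n)) (r%:E * m (f_ n @^-1` [set r])).
    by rewrite integralT_nnsfun sintegralE.
  rewrite sumE (eq_integral _ _ (fun x _ => sumE (k x))) ge0_integral_fsum//.
  - apply: eq_fsbigr => r /[!inE] -[y _ <-].
    rewrite ge0_integralZl//; first by rewrite nuE.
      exact: measurable_kernel.
    by rewrite lee_fin.
  - by move=> r; apply: measurable_funeM; exact: measurable_kernel.
  - move=> r x _; have [r0|r0] := leP 0%R r; first by rewrite mule_ge0.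
    by rewrite preimage_nnfun0// measure0 mule0.
rewrite approx (eq_integral _ _ (fun x _ => approx (k x))) monotone_convergence//.
- by congr (limn _); apply/funext.
- move=> n; apply: measurable_fun_integral_kernel.
  + exact: measurable_kernel.
  + by move=> y; rewrite lee_fin.
  + exact/measurable_EFinP.
- by move=> n x _; apply: integral_ge0 => y _; rewrite lee_fin.
- move=> x _ a b ab; apply: ge0_le_integral => //.
  + by move=> y _; rewrite lee_fin.
  + exact/measurable_EFinP.
  + exact/measurable_EFinP.
  + by move=> y _; rewrite lee_fin nd_f.
Qed.

End integral_mixture.

(** * Total variation and weighted norms *)

Section jordan_split.
Context {R : realType} {dX : measure_display} {X : measurableType dX}.
Local Open Scope ereal_scope.
Implicit Types (a b : probability X R) (Dp Dn : {finite_measure set X -> \bar R}).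

(* A Hahn-Jordan decomposition of a - b, phrased without subtraction. *)
Definition jordan_split a b (P : set X) Dp Dn :=
  [/\ measurable P, Dp (~` P) = 0, Dn P = 0 &
      forall U, measurable U -> a U + Dn U = b U + Dp U].

Lemma jordan_splitC a b P Dp Dn :
  jordan_split a b P Dp Dn -> jordan_split b a (~` P) Dn Dp.
Proof.
by move=> [mP p0 n0 E]; split; rewrite ?setCK//; [exact: measurableC|move=> U mU;
    rewrite E].
Qed.

Lemma jordan_split_setT a b P Dp Dn :
  jordan_split a b P Dp Dn -> Dn setT = Dp setT.
Proof.
move=> [_ _ _ /(_ _ measurableT)]; rewrite !probability_setT => E.
by apply/eqP; rewrite eq_le -(leeD2lE (Dn _) _ (isT : 1%:E \is a fin_num)) -[X in
    _ && X](leeD2lE _ _ (isT : 1%:E \is a fin_num)) E lexx.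
Qed.

(** [tv_norm] and [signed_integral] rest on a Hahn decomposition obtained by choice; these three
    facts are all that is used of it afterwards. *)
Lemma signed_diff_split a b : exists P Dp Dn,
  [/\ jordan_split a b P Dp Dn, tv_norm (signed_diff a b) = Dp setT + Dn setT &
   forall f, signed_integral (signed_diff a b) f =
     \int[Dp]_x (f x)%:E - \int[Dn]_x (f x)%:E].
Proof.
rewrite /tv_norm /signed_integral.
set P := sval _; set N := sval _; set H := svalP _.
exists P, (jordan_pos H), (jordan_neg H); split => //.
have [[mP _] [mN _] PN PN0] := H.
have posE U : measurable U -> jordan_pos H U = a (U `&` P) - b (U `&` P).
  by move=> mU; rewrite jordan_posE cjordan_posE /crestr0 mem_set.
have negE U : measurable U -> jordan_neg H U = - (a (U `&` N) - b (U `&` N)).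
  by move=> mU; rewrite jordan_negE cjordan_negE /crestr0 mem_set.
have CP : ~` P = N.
  by apply/esym/seteqP; split=> x; [move=> Nx Px; have : (P `&` N) x by [];
      rewrite PN0
    | move=> nPx; have : [set: X] x by []; rewrite -PN => -[]].
split=> //.
- rewrite [LHS](posE _ (measurableC mP)).
  by rewrite setICl !measure0 sube0.
- by rewrite [LHS](negE _ mP) PN0 !measure0 sube0 oppe0.
move=> U mU; rewrite [X in _ + X = _](negE _ mU) [X in _ = _ + X](posE _ mU).
have split_ (m : probability X R) : m U = m (U `&` P) + m (U `&` N).
  rewrite -measureU//; [|exact: measurableI|exact: measurableI|].
    by rewrite -setIUr PN setIT.
  by rewrite setIACA PN0 setI0.
have fin (m : probability X R) V : measurable V -> m V = (fine (m V))%:E.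
  by move=> mV; rewrite fineK// fin_num_measure.
have mUP : measurable (U `&` P) by exact: measurableI.
have mUN : measurable (U `&` N) by exact: measurableI.
rewrite (split_ a) (split_ b) (fin a _ mUP) (fin a _ mUN) (fin b _ mUP) (fin b _
    mUN).
by rewrite -!(EFinB,EFinD,EFinN); congr EFin; ring.
Qed.

Lemma jordan_split_integral a b P Dp Dn (f : X -> \bar R) :
  jordan_split a b P Dp Dn -> measurable_fun setT f -> (forall x, 0 <= f x) ->
  \int[a]_x f x + \int[Dn]_x f x = \int[b]_x f x + \int[Dp]_x f x.
Proof.
move=> [_ _ _ E] mf f0.
rewrite -!ge0_integral_measure_add//; apply: eq_measure_integral => U mU _.
by rewrite [LHS]measure_addE [RHS]measure_addE E.
Qed.

(** Against Dn the integral is at least lo times the mass, against Dp at most hi times the mass, and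
    the two masses agree. The gain of a over b is thus at most the oscillation hi - lo times the
    mass; no subtraction is made in [\bar R]. *)
Lemma jordan_split_bounded a b P Dp Dn (f : X -> \bar R) (lo hi : R) :
  jordan_split a b P Dp Dn -> measurable_fun setT f -> (0 <= lo)%R ->
  (forall x, lo%:E <= f x <= hi%:E) ->
  \int[a]_x f x + lo%:E * Dp setT <= \int[b]_x f x + hi%:E * Dp setT.
Proof.
move=> H mf lo0 fb.
have f0 x : 0 <= f x by apply: le_trans (proj1 (andP (fb x))); rewrite lee_fin.
apply: (@le_trans _ _ (\int[a]_x f x + \int[Dn]_x f x)).
  rewrite leeD2l// -(jordan_split_setT H) -integral_cst//.
  by apply: ge0_le_integral => // x _; case/andP: (fb x).
rewrite (jordan_split_integral H mf f0) leeD2l// -integral_cst//.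
apply: ge0_le_integral => //.
by move=> x _; case/andP: (fb x).
Qed.

Lemma jordan_split_supp a b P Dp Dn (f : X -> \bar R) :
  jordan_split a b P Dp Dn -> measurable_fun setT f -> (forall x, 0 <= f x) ->
  \int[Dp]_x f x = \int[Dp]_(x in P) f x /\ \int[Dn]_(x in P) f x = 0.
Proof.
move=> [mP p0 n0 E] mf f0; split.
  rewrite -(setUv P) ge0_integral_setU//.
  - by rewrite [X in _ + X]null_set_integral ?adde0//;
      [exact: measurableC|exact: measurable_funTS].
  - exact: measurableC.
  - by rewrite setUv.
  - by rewrite disj_set2E setICr.
by rewrite null_set_integral//; exact: measurable_funTS.
Qed.

End jordan_split.

(** * Contraction of the Jordan parts under a Markov kernel *)

Section contraction.
Context {R : realType} {dX : measure_display} {X : measurableType dX}.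
Local Open Scope ereal_scope.
Implicit Types (a b : probability X R) (Dp Dn : {finite_measure set X -> \bar R}).

Lemma jordan_split_setTE a b P Dp Dn : jordan_split a b P Dp Dn ->
  a P = b P + Dp setT.
Proof.
move=> [mP p0 n0 E]; rewrite -(setUv P) measureU//; last 2 first.
  exact: measurableC.
  by rewrite setICr.
by rewrite [X in _ + (_ + X)]p0 adde0 -E// n0 adde0.
Qed.

(** Minimality of the Jordan parts, evaluated on P': there Dn' vanishes while Dn is merely
    nonnegative. It compares decompositions of pairs that agree only on measurable sets. *)
Lemma le_jordan_split a b a' b' P Dp Dn P' Dp' Dn' :
  jordan_split a b P Dp Dn -> jordan_split a' b' P' Dp' Dn' ->
  (forall U, measurable U -> a' U = a U) ->
  (forall U, measurable U -> b' U = b U) -> Dp' setT <= Dp setT.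
Proof.
move=> S S' aE bE; have [mP' _ _ _] := S'; have [_ _ _ E] := S.
have bfin : b P' \is a fin_num by exact: fin_num_measure.
rewrite -(leeD2lE _ _ bfin) -(bE _ mP') -(jordan_split_setTE S') (aE _ mP').
apply: (@le_trans _ _ (a P' + Dn P')); first by rewrite leeDl.
by rewrite E// bE// leeD2l// le_measure// inE.
Qed.

Variables (k : R.-pker X ~> X).

Lemma integral_probability_le (f : X -> \bar R) (c : R) (mu : {measure set X ->
    \bar R}) :
  mu setT = 1 -> measurable_fun setT f -> (forall x, 0 <= f x) ->
  (forall x, f x <= c%:E) -> \int[mu]_x f x <= c%:E.
Proof.
move=> mu1 mf f0 fc; apply: (@le_trans _ _ (\int[mu]_x c%:E)).
  by apply: ge0_le_integral => // x _; exact: le_trans (f0 x) (fc x).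
by rewrite integral_cst// mu1 mule1.
Qed.

Section minorized.
Variables (nu : probability X R) (eps : R).
Hypothesis eps0 : (0 <= eps)%R.
Hypothesis minor : forall x U, measurable U -> eps%:E * nu U <= k x U.

(** The mass of Dp' is a' P' - b' P', the integral against a - b of x |-> k x P'. Minorization on P'
    and on its complement confines this function to an interval of length 1 - eps. *)
Lemma doeblin_contraction a b a' b' P Dp Dn P' Dp' Dn' :
  (forall U, measurable U -> a' U = \int[a]_x k x U) ->
  (forall U, measurable U -> b' U = \int[b]_x k x U) ->
  jordan_split a b P Dp Dn -> jordan_split a' b' P' Dp' Dn' ->
  Dp' setT <= (1 - eps)%:E * Dp setT.
Proof.
move=> aE bE S S'; have [mP' _ _ _] := S'.
have mCP' : measurable (~` P') by exact: measurableC.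
have fin (m : {finite_measure set X -> \bar R}) V :
    measurable V -> m V = (fine (m V))%:E.
  by move=> mV; rewrite fineK// fin_num_measure.
have nuC : nu (~` P') = 1 - nu P' by rewrite -probability_setC.
set p := fine (nu P'); set t := fine (Dp setT).
have nuP : nu P' = p%:E by exact: fin.
have bnd x : (eps * p)%:E <= k x P' <= (1 - eps * (1 - p))%:E.
  have := minor x mCP'; have := minor x mP'; rewrite nuC nuP.
  have -> : k x (~` P') = 1 - k x P'.
    rewrite -[X in X - _](@prob_kernel _ _ _ _ _ k x) -(setUv P') measureU//;
        last by rewrite setICr.
    rewrite addeAC subee ?add0e// ge0_fin_numE//.
    apply: (@le_lt_trans _ _ (k x setT)); first by rewrite le_measure// inE.
    by rewrite prob_kernel ltry.
  have kfin : k x P' \is a fin_num.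
    rewrite ge0_fin_numE//; apply: (@le_lt_trans _ _ (k x setT)).
      by rewrite le_measure// inE.
    by rewrite prob_kernel ltry.
  rewrite -(fineK kfin) -!EFinB -!EFinM !lee_fin => h1 h2.
  by apply/andP; split; [|lra].
have lo0 : (0 <= eps * p)%R by rewrite mulr_ge0// fine_ge0.
have := jordan_split_bounded S (measurable_kernel k _ mP') lo0 bnd.
rewrite -aE// -bE// (jordan_split_setTE S').
rewrite (fin b' _ mP') (fin Dp' _ measurableT) (fin Dp _ measurableT) -/t.
by rewrite -!(EFinD,EFinM,EFinB) !lee_fin => h; lra.
Qed.

End minorized.

Section weighted.
Variables (c : R).

(** Cut f to the positive set P' of the image: the integral against Dp' is unchanged and the one
    against Dn' vanishes. What remains is a difference of integrals against a and b of a function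
    with values in [0, c]; the bound c also makes the b-integral finite, so that it can be
    cancelled. *)
Lemma jordan_split_kernel_integral a b a' b' P Dp Dn P' Dp' Dn' (f : X -> \bar R) :
  measurable_fun setT f -> (forall x, 0 <= f x) ->
  (forall x, \int[k x]_y f y <= c%:E) ->
  (forall U, measurable U -> a' U = \int[a]_x k x U) ->
  (forall U, measurable U -> b' U = \int[b]_x k x U) ->
  jordan_split a b P Dp Dn -> jordan_split a' b' P' Dp' Dn' ->
  \int[Dp']_x f x <= c%:E * Dp setT.
Proof.
move=> mf f0 fc aE bE S S'; have [mP' _ _ _] := S'.
pose g := f \_ P'.
have mg : measurable_fun setT g by apply/(measurable_restrictT f mP');
    exact: measurable_funTS.
have g0 x : 0 <= g x by rewrite /g patchE; case: ifP.
have gf x : g x <= f x by rewrite /g patchE; case: ifP.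
have [-> _] := jordan_split_supp S' mf f0.
have [_ n0] := jordan_split_supp S' mf f0.
rewrite integral_mkcond -/g.
rewrite integral_mkcond -/g in n0.
have /= := jordan_split_integral S' mg g0; rewrite n0 adde0.
have kg x : 0 <= \int[k x]_y g y <= c%:E.
  rewrite integral_ge0//=; apply: le_trans (fc x).
  by apply: ge0_le_integral.
have mkg : measurable_fun setT (fun x => \int[k x]_y g y).
  by apply: measurable_fun_integral_kernel => //; exact: measurable_kernel.
rewrite (ge0_integral_mixture aE)// (ge0_integral_mixture bE)// => E.
have := jordan_split_bounded S mkg (lexx 0%R) kg.
rewrite mul0e adde0 E leeD2lE// ge0_fin_numE.
  apply: (@le_lt_trans _ _ c%:E); last exact: ltry.
  apply: integral_probability_le => //; first exact: probability_setT.
    by move=> x; case/andP: (kg x).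
  by move=> x; case/andP: (kg x).
by apply: integral_ge0 => x _; case/andP: (kg x).
Qed.

End weighted.
End contraction.

Section weighted_norm.
Context {R : realType} {dX : measure_display} {X : measurableType dX}.
Local Open Scope ereal_scope.
Variables (V : X -> \bar R) (V1 : forall x, 1 <= V x).

Lemma fun_wnorm_le1 (f : X -> R) : fun_wnorm V f <= 1 -> forall x, `|(f x)%:E| <=
    V x.
Proof.
move=> fV x; have := V1 x; case Vx : (V x) => [v| |] //; last by move=> _;
    rewrite leey.
rewrite lee_fin => v1; have v0 : (0 < v)%R by exact: lt_le_trans v1.
have : `|(f x)%:E / V x| <= 1 by apply: le_trans fV; apply: ereal_sup_ubound;
    exists x.
rewrite Vx inver gt_eqF// -EFinM !abse_EFin !lee_fin normrM (ger0_norm (_ : 0 <=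
    v^-1)%R).
  by rewrite ler_pdivrMr// mul1r.
by rewrite invr_ge0 ltW.
Qed.

(** Test with the sign of the Hahn decomposition, 1 on P and -1 outside; it is admissible because 1
    <= V. *)
Lemma tv_norm_le_wnorm (a b : probability X R) :
  tv_norm (signed_diff a b) <= wnorm (signed_diff a b) V.
Proof.
have [P [Dp [Dn [S -> fE]]]] := signed_diff_split a b.
have [mP p0 n0 _] := S; have mCP : measurable (~` P) by exact: measurableC.
pose f : X -> R := (\1_P \- \1_(~` P))%R.
apply: le_trans (_ : `|signed_integral (signed_diff a b) f| <= _); last first.
  apply: ereal_sup_ubound; exists f => //; split.
    by apply: measurable_funB; exact: measurable_indic.
  apply: ge_ereal_sup => _ [x _ <-]; rewrite abseM.
  have f1 : `|(f x)%:E| = 1.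
    rewrite /f/= !indicE in_setC; case: (x \in P) => /=.
      by rewrite subr0 normr1.
    by rewrite sub0r normrN normr1.
  rewrite f1 mul1e; have := V1 x; case: (V x) => [v| |] //.
    rewrite lee_fin => v1; have v0 : (0 < v)%R by exact: lt_le_trans v1.
    rewrite inver gt_eqF// abse_EFin lee_fin ger0_norm ?invr_ge0; last exact: ltW.
    by rewrite invf_le1.
  by rewrite invey abse0.
have split_ (D : {finite_measure set X -> \bar R}) :
    \int[D]_x (f x)%:E = D P - D (~` P).
  rewrite /f; under eq_integral do rewrite EFinB.
  rewrite integralB//; last 2 first.
    exact: integrable_indic.
    exact: integrable_indic.
  by rewrite !integral_indic// !setIT.
rewrite fE !split_ p0 n0 sube0 sub0e oppeK.
have DpE : Dp setT = Dp P.
  by rewrite -(setUv P) measureU ?setICr// [X in _ + X]p0 adde0.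
have DnE : Dn setT = Dn (~` P).
  by rewrite -(setUv P) measureU ?setICr// [X in X + _]n0 add0e.
by rewrite DpE DnE gee0_abs// adde_ge0.
Qed.

End weighted_norm.

(** * Doeblin's theorem *)

Section residual.
Context {R : realType} {dX : measure_display} {X : measurableType dX}.
Local Open Scope ereal_scope.
Variables (k : R.-pker X ~> X) (nu : probability X R) (eps : R).
Hypothesis eps01 : (0 < eps < 1)%R.
Hypothesis minor : forall x U, measurable U -> eps%:E * nu U <= k x U.

(** Minorization is assumed on measurable sets only, whereas the measure structure asks for
    nonnegativity on every set: hence the value 0 elsewhere. *)
Definition residual (x : X) (U : set X) : \bar R :=
  if `[< measurable U >] then k x U - eps%:E * nu U else 0.

Let nu_fin U : measurable U -> eps%:E * nu U \is a fin_num.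
Proof. by move=> mU; rewrite fin_numM// fin_num_measure. Qed.

Let residualE x U : measurable U -> residual x U = k x U - eps%:E * nu U.
Proof. by move=> mU; rewrite /residual asboolT. Qed.

Let residual0 x : residual x set0 = 0.
Proof. by rewrite residualE// !measure0 mule0 sube0. Qed.

Let residual_ge0 x U : 0 <= residual x U.
Proof.
rewrite /residual; case: asboolP => // mU.
by rewrite sube_ge0 ?minor// nu_fin.
Qed.

Let residual_sigma_additive x : semi_sigma_additive (residual x).
Proof.
move=> F mF tF mUF; rewrite residualE//.
rewrite (_ : (fun n => _) = (fun n => \sum_(0 <= i < n) k x (F i)
    - eps%:E * \sum_(0 <= i < n) nu (F i))); last first.
  apply/funext => n.
  under eq_bigr do rewrite residualE//.
  elim: n => [|n ih]; first by rewrite !big_geq// mule0 sube0.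
  rewrite !big_nat_recr//= ih.
  have finS : (\sum_(0 <= i < n) nu (F i))%R \is a fin_num.
    by apply/sum_fin_numP => i _ _; exact: fin_num_measure.
  rewrite ge0_muleDr ?sume_ge0//.
  by rewrite fin_num_oppeD ?nu_fin// addeACA.
apply: cvgeB.
- by rewrite fin_num_adde_defl// fin_numN nu_fin.
- exact: measure_semi_sigma_additive.
- apply: cvgeZl => //.
  exact: measure_semi_sigma_additive.
Qed.

HB.instance Definition _ x := isMeasure.Build _ _ _ (residual x)
  (residual0 x) (residual_ge0 x) (@residual_sigma_additive x).

Definition residual_kernel : X -> {measure set X -> \bar R} := residual.

Let measurable_residual U : measurable U ->
  measurable_fun setT (residual_kernel ^~ U).
Proof.
move=> mU; rewrite [X in measurable_fun _ X](_ : _ = fun x => k x U - eps%:E * nu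
    U).
  by apply: emeasurable_funB => //; exact: measurable_kernel.
by apply/funext => x; exact: residualE.
Qed.

HB.instance Definition _ := isKernel.Build _ _ _ _ _
  residual_kernel measurable_residual.

Lemma residual_kernelE x U : measurable U ->
  k x U = residual_kernel x U + eps%:E * nu U.
Proof. by move=> mU; rewrite [X in X + _]residualE// subeK// nu_fin. Qed.

Let eps_nng : {nonneg R} := NngNum (ltW (proj1 (andP eps01))).

(* eps nu Q^n, with Q the residual kernel *)
Fixpoint regeneration (n : nat) : {measure set X -> \bar R} :=
  match n with
  | 0 => mscale eps_nng nu
  | n'.+1 => mixture (regeneration n') residual_kernel
  end.

Lemma regeneration_setT n : regeneration n setT = (eps * (1 - eps) ^+ n)%:E.
Proof.
elim: n => [|n ih] /=.
  by rewrite expr0 mulr1 /mscale/= [X in _ * X]probability_setT mule1.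
have q1 x : residual_kernel x setT = (1 - eps)%:E.
  rewrite [LHS](residualE _ measurableT) prob_kernel.
  by rewrite [X in _ * X]probability_setT mule1 -EFinB.
rewrite /mixture (eq_integral _ _ (fun x _ => q1 x)).
rewrite integral_cst//= [X in _ * X]ih -EFinM exprSr mulrA mulrC.
by congr EFin; ring.
Qed.

(** The sum runs over the time elapsed since the last regeneration; by [regeneration_setT] its mass
    is a geometric series with sum 1. *)
Definition invariant_measure : set X -> \bar R := mseries regeneration 0.
HB.instance Definition _ := Measure.on invariant_measure.

Let invariant_measure_setT : invariant_measure setT = 1.
Proof.
rewrite /invariant_measure /mseries.
under eq_eseriesr do rewrite regeneration_setT.
have [e0 e1] := andP eps01.
have h := @cvg_geometric_series R eps (1 - eps)%R.
have /h : (`|1 - eps| < 1)%R by rewrite ger0_norm; lra.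
rewrite subKr divff ?gt_eqF// => cv.
apply/cvg_lim => //.
rewrite (_ : (fun n => _) = EFin \o series (geometric eps (1 - eps)%R)).
  by apply/fine_cvgP; split=> //; exact: nearW.
by apply/funext => n; rewrite /= /series/= sumEFin.
Qed.

HB.instance Definition _ := Measure_isProbability.Build _ _ _
  invariant_measure invariant_measure_setT.

(** As k = Q + eps nu, applying k to the n-th term gives the next term plus eps nu times the mass of
    the n-th. These masses sum to 1, so the second contributions restore the missing initial
    term. *)
Lemma invariant_measureP : is_invariant k invariant_measure.
Proof.
move=> U mU; rewrite /markov_act ge0_integral_measure_series//; last first.
  exact: measurable_kernel.
have step n : \int[regeneration n]_x k x U =
    regeneration n.+1 U + eps%:E * nu U * regeneration n setT.
  under eq_integral do rewrite residual_kernelE//.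
  rewrite ge0_integralD//; first by rewrite integral_cst.
    exact: measurable_residual.
  by move=> x _; rewrite mule_ge0// lee_fin ltW//; case/andP: eps01.
have nu0 : 0 <= eps%:E * nu U by rewrite mule_ge0// lee_fin ltW//; case/andP: eps01.
under eq_eseriesr do rewrite step.
rewrite nneseriesD//; last by move=> n _; rewrite mule_ge0.
rewrite -(fineK (nu_fin mU)) nneseriesZl//.
have -> : \sum_(0 <= i <oo) regeneration i setT = 1 := invariant_measure_setT.
rewrite mule1 addeC fineK ?nu_fin// [RHS]nneseries_recl//; congr (_ + _).
rewrite -[RHS](nneseries_addn (f := fun n => regeneration n U))//.
by apply: eq_eseriesr => n _; rewrite addn1.
Qed.

End residual.

Section doeblin.
Context {R : realType} {dX : measure_display} {X : measurableType dX}.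
Local Open Scope ereal_scope.
Variables (k : R.-pker X ~> X) (nu : probability X R) (eps : R).
Hypothesis eps01 : (0 < eps < 1)%R.
Hypothesis minor : forall x U, measurable U -> eps%:E * nu U <= k x U.

Lemma markov_act_iter0 (mu : probability X R) U : measurable U ->
  markov_act mu (markov_iter k 0) U = mu U.
Proof.
move=> mU; rewrite [LHS](_ : _ = \int[mu]_x (\1_U x)%:E).
  by rewrite integral_indic// setIT.
by apply: eq_integral => x _; rewrite /= /kdirac diracE indicE.
Qed.

Lemma markov_act_iterS (mu : probability X R) n U : measurable U ->
  markov_act mu (markov_iter k n.+1) U =
  \int[markov_act mu (markov_iter k n)]_x k x U.
Proof.
move=> mU; rewrite (@ge0_integral_mixture _ _ _ _ _ mu _ (markov_iter k n))//.
exact: measurable_kernel.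
Qed.

Lemma doeblin_contraction_iter n (a b : probability X R) P Dp Dn P' Dp' Dn' :
  jordan_split a b P Dp Dn ->
  jordan_split (markov_act a (markov_iter k n)) (markov_act b (markov_iter k n))
    P' Dp' Dn' ->
  Dp' setT <= ((1 - eps) ^+ n)%:E * Dp setT.
Proof.
move=> S; elim: n P' Dp' Dn' => [|n ih] P' Dp' Dn' S'.
  rewrite expr0 mul1e; apply: (le_jordan_split S S') => U mU;
    exact: markov_act_iter0.
have [P1 [Dp1 [Dn1 [S1 _ _]]]] := signed_diff_split
  (markov_act a (markov_iter k n)) (markov_act b (markov_iter k n)).
have [e0 e1] := andP eps01.
apply: le_trans (doeblin_contraction (ltW e0) minor _ _ S1 S') _.
- by move=> U mU; exact: markov_act_iterS.
- by move=> U mU; exact: markov_act_iterS.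
rewrite exprS EFinM -muleA; apply: lee_wpmul2l; last exact: ih S1.
by rewrite lee_fin subr_ge0 ltW.
Qed.

Lemma invariant_unique (a b : probability X R) :
  is_invariant k a -> is_invariant k b -> forall U, measurable U -> a U = b U.
Proof.
move=> ia ib U mU.
have [P [Dp [Dn [S _ _]]]] := signed_diff_split a b.
have [e0 e1] := andP eps01.
have := doeblin_contraction (ltW e0) minor (fun U mU => esym (ia U mU))
  (fun U mU => esym (ib U mU)) S S.
have Dp0 : 0 <= Dp setT by [].
rewrite -(fineK (fin_num_measure Dp _ measurableT)) -EFinM lee_fin => h.
have {}Dp0 : Dp setT = 0.
  rewrite -(fineK (fin_num_measure Dp _ measurableT)); congr EFin.
  have : (0 <= fine (Dp setT))%R by exact: fine_ge0.
  by nra.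
have Dn0 := jordan_split_setT S; rewrite Dp0 in Dn0.
have null (D : {finite_measure set X -> \bar R}) : D setT = 0 -> D U = 0.
  move=> D0; apply/eqP; rewrite eq_le measure_ge0 andbT -D0.
  by rewrite le_measure// inE.
by have [_ _ _ /(_ _ mU)] := S; rewrite (null Dn Dn0) (null Dp Dp0) !adde0.
Qed.

Variables (V : X -> \bar R) (c : R).
Hypotheses (mV : measurable_fun setT V) (V1 : forall x, 1 <= V x).
Hypothesis kV : forall x, \int[k x]_y V y <= c%:E.

(** The first n steps contract the mass of the parts and the last one converts mass into V-mass
    through [kV]: hence the exponent n for n + 1 steps, and a right-hand side in total variation. *)
Lemma wnorm_iter_le n (a b : probability X R) P Dp Dn :
  jordan_split a b P Dp Dn ->
  wnorm (signed_diff (markov_act a (markov_iter k n.+1))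
                     (markov_act b (markov_iter k n.+1))) V
    <= (c * (1 - eps) ^+ n)%:E * (Dp setT + Dn setT).
Proof.
move=> S.
set a' := markov_act a (markov_iter k n.+1).
set b' := markov_act b (markov_iter k n.+1).
have [P' [Dp' [Dn' [S' _ fE]]]] := signed_diff_split a' b'.
have [P1 [Dp1 [Dn1 [S1 _ _]]]] := signed_diff_split
  (markov_act a (markov_iter k n)) (markov_act b (markov_iter k n)).
apply: ge_ereal_sup => _ [f [mf fV] <-]; rewrite fE.
have {}fV := fun_wnorm_le1 V1 fV.
have mg : measurable_fun setT (fun x => `|(f x)%:E|).
  by apply: measurableT_comp => //; exact/measurable_EFinP.
have kg x : \int[k x]_y `|(f y)%:E| <= c%:E.
  by apply: le_trans (kV x); apply: ge0_le_integral.
have aE U : measurable U -> a' U = _ := @markov_act_iterS a n U.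
have bE U : measurable U -> b' U = _ := @markov_act_iterS b n U.
have hp := jordan_split_kernel_integral mg (fun x => abse_ge0 _) kg aE bE S1 S'.
have hn := jordan_split_kernel_integral mg (fun x => abse_ge0 _) kg bE aE
  (jordan_splitC S1) (jordan_splitC S').
have c0 : (0 <= c)%R.
  rewrite -lee_fin; apply: le_trans (kV point).
  by apply: integral_ge0 => y _; apply: le_trans (V1 y).
apply: (@le_trans _ _ (c%:E * (Dp1 setT + Dn1 setT))).
  apply: le_trans (lee_abs_sub _ _) _; rewrite ge0_muleDr//.
  apply: leeD; [apply: le_trans hp|apply: le_trans hn];
      apply: le_abse_integral => //;
    exact/measurable_EFinP.
rewrite EFinM -muleA; apply: lee_wpmul2l; first by rewrite lee_fin.
rewrite ge0_muleDr//; apply: leeD; first exact: doeblin_contraction_iter S S1.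
by rewrite (jordan_split_setT S1) (jordan_split_setT S);
    exact: doeblin_contraction_iter S S1.
Qed.

Theorem doeblin_weighted_ergodicity :
  (exists pi : probability X R,
    [/\ \int[pi]_x V x < +oo, is_invariant k pi
      & forall pi' : probability X R, is_invariant k pi' ->
          forall U, measurable U -> pi' U = pi U]) /\
  (exists a b : R,
    [/\ (0 < a)%R, (0 < b)%R
      & forall (n : nat) (mu1 mu2 : probability X R), (1 <= n)%N ->
          let kn := markov_iter k n in
          wnorm (signed_diff (markov_act mu1 kn) (markov_act mu2 kn)) V
             <= (a * expR (- (b * n%:R)))%:E * wnorm (signed_diff mu1 mu2) V
          /\
          tv_norm (signed_diff (markov_act mu1 kn) (markov_act mu2 kn))
             <= (a * expR (- (b * n%:R)))%:E * tv_norm (signed_diff mu1 mu2)]).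
Proof.
have [e0 e1] := andP eps01.
have V0 x : 0 <= V x by exact: le_trans (V1 x).
have q0 : (0 < 1 - eps)%R by rewrite subr_gt0.
split.
  pose pi : probability X R := invariant_measure eps01 minor.
  have ipi : is_invariant k pi by exact: invariant_measureP.
  exists pi; split => //; last by move=> pi' ipi'; exact: invariant_unique.
  (* By invariance, the integral of V against pi is that of x |-> [\int[k x]_y V y], which is at
     most c. *)
  apply: (@le_lt_trans _ _ c%:E); last exact: ltry.
  rewrite (ge0_integral_mixture (fun U mU => esym (ipi U mU)))//.
  apply: integral_probability_le => //; first exact: probability_setT.
    by apply: measurable_fun_integral_kernel => //; exact: measurable_kernel.
  by move=> x; exact: integral_ge0.
(* With this b the exponential is (1 - eps)^n. Dividing by 1 - eps makes up for the step spent on V,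
   and the maximum with 1 covers total variation, where c does not occur. *)
pose a := (Num.max c 1 / (1 - eps))%R; pose b := (- ln (1 - eps))%R.
have a0 : (0 < a)%R by rewrite divr_gt0// lt_max ltr01 orbT.
exists a, b; split => //.
  by rewrite oppr_gt0 ln_lt0// q0/= ltrBlDr ltrDl.
move=> [//|n] mu1 mu2 _ kn.
have -> : (a * expR (- (b * n.+1%:R)) = Num.max c 1 * (1 - eps) ^+ n)%R.
  rewrite /b mulNr opprK expRM_natr lnK ?posrE// exprS /a.
  by field; rewrite gt_eqF.
have [P [Dp [Dn [S tvE _]]]] := signed_diff_split mu1 mu2.
have qn0 : (0 <= (1 - eps) ^+ n)%R by rewrite exprn_ge0// ltW.
split.
  apply: le_trans (wnorm_iter_le n S) _.
  apply: (@le_trans _ _ ((Num.max c 1 * (1 - eps) ^+ n)%:E * (Dp setT + Dn setT))).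
    apply: lee_wpmul2r; first by rewrite adde_ge0.
    by rewrite lee_fin ler_wpM2r// le_max lexx.
  apply: lee_wpmul2l; first by rewrite lee_fin mulr_ge0// le_max ler01 orbT.
  by rewrite -tvE; exact: tv_norm_le_wnorm.
have [P' [Dp' [Dn' [S' -> _]]]] :=
  signed_diff_split (markov_act mu1 kn) (markov_act mu2 kn).
rewrite tvE (jordan_split_setT S) (jordan_split_setT S') ge0_muleDr//.
have h : Dp' setT <= (Num.max c 1 * (1 - eps) ^+ n)%:E * Dp setT.
  apply: le_trans (doeblin_contraction_iter S S') _; apply: lee_wpmul2r => //.
  rewrite lee_fin exprS ler_wpM2r//.
  by rewrite le_max; apply/orP; right; lra.
exact: leeD.
Qed.

End doeblin.

(** * Integration over independent coordinates *)

Section iid_integral.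
Context {R : realType} {dT : measure_display} {T : measurableType dT}.
Local Open Scope ereal_scope.
Implicit Types (P Q : probability T R).

Lemma measurable_tuple_cons n :
  measurable_fun [set: T * n.-tuple T] (@tuple_cons _ T n).
Proof. exact: measurable_cons. Qed.

Lemma ge0_integral_iidS P n (f : n.+1.-tuple T -> \bar R) :
  measurable_fun setT f -> (forall w, 0 <= f w) ->
  \int[iid P n.+1]_w f w = \int[P]_x \int[iid P n]_w f (tuple_cons (x, w)).
Proof.
move=> mf f0; rewrite [LHS]ge0_integral_distribution//.
have mg : measurable_fun setT (f \o @tuple_cons _ T n).
  by apply: measurableT_comp => //; exact: measurable_tuple_cons.
transitivity (\int[P \x iid P n]_z (f \o @tuple_cons _ T n) z).
  by apply: eq_measure_integral.
rewrite (@fubini_tonelli1 _ _ _ _ _ P (iid P n) (f \o @tuple_cons _ T n))//.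
by move=> xw; exact: f0.
Qed.

Definition tuple_update n (w : n.-tuple T) (k : 'I_n) (x : T) : n.-tuple T :=
  [tuple if i == k then x else tnth w i | i < n].

Lemma measurable_tuple_update n (k : 'I_n) :
  measurable_fun setT (fun wx : n.-tuple T * T => tuple_update wx.1 k wx.2).
Proof.
apply/measurable_fun_tnthP => i.
rewrite (_ : _ \o _ = fun wx => if i == k then wx.2 else tnth wx.1 i).
  case: (i == k); first exact: measurable_snd.
  exact: (measurableT_comp (measurable_tnth i) measurable_fst).
by apply/funext => wx /=; rewrite tnth_mktuple.
Qed.

Lemma tuple_update_cons0 n (x y : T) (w : n.-tuple T) :
  tuple_update (tuple_cons (y, w)) ord0 x = tuple_cons (x, w).
Proof.
apply: eq_from_tnth => i; rewrite tnth_mktuple /=.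
case: (unliftP ord0 i) => [j|] ->; last by rewrite eqxx.
by rewrite !tnthS.
Qed.

Lemma tuple_update_consS n (x y : T) (w : n.-tuple T) (k : 'I_n) :
  tuple_update (tuple_cons (y, w)) (lift ord0 k) x =
  tuple_cons (y, tuple_update w k x).
Proof.
apply: eq_from_tnth => i; rewrite tnth_mktuple /=.
case: (unliftP ord0 i) => [j|] ->; last by rewrite !tnth0.
by rewrite !tnthS tnth_mktuple (inj_eq lift_inj).
Qed.

(** Resampling one coordinate preserves a product law; this is Fubini for coordinate k without
    reordering the tuple. *)
Lemma ge0_integral_iid_update P n (k : 'I_n) (f : n.-tuple T -> \bar R) :
  measurable_fun setT f -> (forall w, 0 <= f w) ->
  \int[iid P n]_w f w = \int[iid P n]_w \int[P]_x f (tuple_update w k x).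
Proof.
elim: n k f => [[]//|n ih] k f mf f0.
have mfu (m : 'I_n.+1) : measurable_fun setT
    (fun wx : n.+1.-tuple T * T => f (tuple_update wx.1 m wx.2)).
  by apply: (measurableT_comp mf); exact: measurable_tuple_update.
have mfc : measurable_fun setT (f \o @tuple_cons _ T n).
  by apply: measurableT_comp => //; exact: measurable_tuple_cons.
rewrite [RHS]ge0_integral_iidS; last 2 first.
- exact: (@measurable_fun_fubini_tonelli_F _ _ _ _ _ P _ (mfu k)).
- by move=> w; exact: integral_ge0.
rewrite ge0_integral_iidS//.
case: (unliftP ord0 k) => [j|] ->.
  apply: eq_integral => y _; rewrite (ih j)//.
    apply: eq_integral => w _; apply: eq_integral => x _.
    by rewrite tuple_update_consS.
  apply: (measurableT_comp mfc) => //.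
under [RHS]eq_integral => y _ do under eq_integral => w _ do
  under eq_integral => x _ do rewrite tuple_update_cons0.
rewrite integral_cst// [X in _ * X]probability_setT mule1.
rewrite (@fubini_tonelli _ _ _ _ _ P (iid P n) (f \o @tuple_cons _ T n))// => xw.
exact: f0.
Qed.

(** One-coordinate dominations multiply: peel off the first coordinate and apply its hypothesis to
    the partial integral over the others. This carries [normal_prob_shift_ge] over to Gaussian
    tuples. *)
Lemma ge0_le_integral_iid P Q n (h : 'I_n -> T -> T) (e : 'I_n -> R)
    (f : n.-tuple T -> \bar R) :
  (forall i, measurable_fun setT (h i)) -> (forall i, (0 <= e i)%R) ->
  (forall i (g : T -> \bar R), measurable_fun setT g -> (forall x, 0 <= g x) ->
    (e i)%:E * \int[Q]_x g x <= \int[P]_x g (h i x)) ->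
  measurable_fun setT f -> (forall w, 0 <= f w) ->
  (\prod_i e i)%:E * \int[iid Q n]_w f w <=
    \int[iid P n]_w f [tuple h i (tnth w i) | i < n].
Proof.
elim: n h e f => [|n ih] h e f mh e0 he mf f0.
  rewrite big_ord0 mul1e; rewrite le_eqVlt; apply/orP; left; apply/eqP;
      apply: eq_integral => w _.
  by congr f; apply: eq_from_tnth => -[].
have mmap : measurable_fun setT
    (fun w : n.+1.-tuple T => [tuple h i (tnth w i) | i < n.+1]).
  apply/measurable_fun_tnthP => i; rewrite (_ : _ \o _ = h i \o @tnth _ T ^~ i).
    by apply: (measurableT_comp (mh i)); exact: measurable_tnth.
  by apply/funext => w /=; rewrite tnth_mktuple.
have mfc : measurable_fun setT (f \o @tuple_cons _ T n).
  by apply: measurableT_comp => //; exact: measurable_tuple_cons.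
rewrite !ge0_integral_iidS//; last exact: (measurableT_comp mf).
rewrite big_ord_recl EFinM -muleA.
pose h' i := h (lift ord0 i); pose e' i := e (lift ord0 i).
have e'0 : (0 <= \prod_i e' i)%R by apply: prodr_ge0 => i _; exact: e0.
pose G x := \int[iid Q n]_w f (tuple_cons (x, w)).
have mG : measurable_fun setT G.
  by apply: (@measurable_fun_fubini_tonelli_F _ _ _ _ _ (iid Q n) _ mfc) => xw;
      exact: f0.
have G0 x : 0 <= G x by exact: integral_ge0.
apply: (@le_trans _ _ (\int[P]_x ((\prod_i e' i)%:E * G (h ord0 x)))).
  rewrite -ge0_integralZl//; last by move=> x _; exact: G0.
  apply: (he ord0 (fun x => (\prod_i e' i)%:E * G x)).
    exact: measurable_funeM.
  by move=> x; rewrite mule_ge0.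
apply: ge0_le_integral => //.
- by move=> x _; rewrite mule_ge0// integral_ge0.
- by apply: measurable_funeM; apply: measurableT_comp.
- have mg : measurable_fun setT (fun xw : T * n.-tuple T =>
    f [tuple h i (tnth (tuple_cons xw) i) | i < n.+1]).
    apply: (measurableT_comp (measurableT_comp mf mmap)).
    exact: measurable_tuple_cons.
  exact: (@measurable_fun_fubini_tonelli_F _ _ _ _ _ (iid P n) _ mg).
- move=> x _; have := ih h' e' (fun w => f (tuple_cons (h ord0 x, w)))
    (fun i => mh _) (fun i => e0 _) (fun i => he _).
  rewrite -/(G _) => /(_ _ _)/le_trans; apply => //.
    by apply: (measurableT_comp mfc).
  rewrite le_eqVlt; apply/orP; left; apply/eqP; apply: eq_integral => w _.
  congr f; apply: eq_from_tnth => i; rewrite [RHS]tnth_mktuple.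
  case: (unliftP ord0 i) => [j|] ->; last by rewrite !tnth0.
  by rewrite !tnthS tnth_mktuple.
Qed.

End iid_integral.

(** * One-dimensional Gaussian estimates *)

Section gaussian.
Context {R : realType}.
Local Notation mu := (@lebesgue_measure R).
Local Open Scope ereal_scope.

Definition translation (m : R) (x : measurableTypeR R) : measurableTypeR R :=
  (x + m)%R.

Lemma measurable_translation m : measurable_fun setT (translation m).
Proof. exact: measurable_funD. Qed.

Lemma lebesgue_measure_translation (m : R) U : measurable U ->
  pushforward mu (translation m) U = mu U.
Proof.
move=> mU; apply/esym/lebesgue_measure_unique => //=.
  exact: measurable_translation.
move=> _ _ [[a b]] _ <-; rewrite /pushforward.
rewrite [RHS](_ : _ = mu `]a - m, b - m]%classic)%R.
  rewrite /= !lebesgue_measure_itv/= !lte_fin ltrD2r; case: ifP => // _.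
  by rewrite -!EFinB; congr EFin; ring.
by congr (mu _); apply/seteqP; split => x /=; rewrite !in_itv/= /translation; lra.
Qed.

Section density.
Variables m s : R.

(** Point masses weighted by the normal density: their mixture over Lebesgue measure is the normal
    law, so [ge0_integral_mixture] yields integration against a density. *)
Let density (x : measurableTypeR R) : {measure set (measurableTypeR R) -> \bar R} :=
  mscale (NngNum (normal_pdf_ge0 m s x)) \d_x.

Let measurable_density U : measurable U -> measurable_fun setT (density ^~ U).
Proof.
move=> mU; rewrite [X in measurable_fun _ X](_ : _ =
    fun x => (normal_pdf m s x * \1_U x)%:E).
  apply/measurable_EFinP; apply: measurable_funM => //.
  exact: measurable_normal_pdf.
by apply/funext => x; rewrite /density/= /mscale/= diracE EFinM indicE.
Qed.

HB.instance Definition _ := isKernel.Build _ _ _ _ _ density measurable_density.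

Lemma ge0_integral_normal_prob (f : measurableTypeR R -> \bar R) :
  measurable_fun setT f -> (forall x, 0 <= f x) ->
  \int[normal_prob m s]_x f x = \int[mu]_x (f x * (normal_pdf m s x)%:E).
Proof.
move=> mf f0; rewrite (@ge0_integral_mixture _ _ _ _ _ mu _ density)//.
  apply: eq_integral => x _; rewrite ge0_integral_mscale//= integral_dirac//.
  by rewrite diracT mul1e muleC.
move=> U mU; rewrite /= /normal_prob integral_mkcond; apply: eq_integral => x _.
by rewrite /= /mscale/= patchE diracE; case: ifP => _; rewrite ?mule1 ?mule0.
Qed.

End density.

Lemma ge0_integral_normal_prob_shift (m : R) (f : measurableTypeR R -> \bar R) :
  measurable_fun setT f -> (forall x, 0 <= f x) ->
  \int[normal_prob 0 1]_x f (translation m x) = \int[normal_prob m 1]_x f x.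
Proof.
move=> mf f0.
have mshift := measurable_translation m.
pose g x := f x * (normal_pdf m 1 x)%:E.
have mg : measurable_fun setT g.
  apply: emeasurable_funM => //; apply/measurable_EFinP.
  exact: measurable_normal_pdf.
have g0 x : 0 <= g x by rewrite mule_ge0// lee_fin normal_pdf_ge0.
rewrite [RHS]ge0_integral_normal_prob//.
rewrite [LHS](@ge0_integral_normal_prob _ _ (f \o translation m)); last 2 first.
- exact: measurableT_comp.
- by move=> x; exact: f0.
transitivity (\int[pushforward mu (translation m)]_x g x); last first.
  by apply: eq_measure_integral => U mU _; exact: lebesgue_measure_translation.
rewrite [RHS](ge0_integral_pushforward mshift mu measurableT mg); last first.
  by move=> x _; exact: g0.
apply: eq_integral => x _; rewrite /g/= /translation; congr (_ * _%:E).
rewrite !normal_pdfE ?oner_eq0//= /normal_fun; congr (_ * expR _)%R.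
by congr (- _ ^+ 2 / _)%R; ring.
Qed.

(* The density of N(m, 1) dominates, up to a constant, that of N(0, 1/2),
   because (x - m)^2 / 2 <= x^2 + m^2. *)
Lemma normal_prob_shift_ge (m : R) (f : measurableTypeR R -> \bar R) :
  measurable_fun setT f -> (forall x, 0 <= f x) ->
  (expR (- m ^+ 2) / Num.sqrt 2)%:E * \int[normal_prob 0 (Num.sqrt 2)^-1]_x f x
    <= \int[normal_prob 0 1]_x f (translation m x).
Proof.
move=> mf f0; rewrite ge0_integral_normal_prob_shift// !ge0_integral_normal_prob//.
have s0 : (0 < Num.sqrt 2 :> R)%R by rewrite sqrtr_gt0.
have mN (a b : R) : measurable_fun setT (fun x => f x * (normal_pdf a b x)%:E).
  by apply: emeasurable_funM => //; apply/measurable_EFinP;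
      exact: measurable_normal_pdf.
have e0 : (0 <= expR (- m ^+ 2) / Num.sqrt 2)%R by rewrite divr_ge0 ?expR_ge0// ltW.
rewrite -ge0_integralZl//; last first.
  by move=> x _; rewrite mule_ge0// lee_fin normal_pdf_ge0.
apply: ge0_le_integral => //.
- by move=> x _; rewrite !mule_ge0// lee_fin normal_pdf_ge0.
- exact: measurable_funeM.
move=> x _; rewrite muleCA; apply: lee_wpmul2l => //.
rewrite -EFinM lee_fin !normal_pdfE ?oner_eq0 ?invr_eq0 ?gt_eqF//=.
rewrite /normal_fun /normal_peak subr0 expr1n exprVn sqr_sqrtr//.
have -> : (Num.sqrt (1 * pi *+ 2) = Num.sqrt 2 * Num.sqrt (2^-1 * pi *+ 2) :> R)%R.
  by rewrite -sqrtrM//; congr Num.sqrt; field.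
rewrite invfM -!mulrA mulrCA; apply: ler_wpM2l; first by rewrite invr_ge0 ltW.
rewrite mulrCA; apply: ler_wpM2l; first by rewrite invr_ge0.
rewrite -expRD ler_expR; have := sqr_ge0 (x + m).
rewrite !mulr2n; set h := (2^-1)%R; have hE : (h + h = 1)%R by rewrite /h; field.
rewrite hE divr1 => h1.
rewrite ler_pdivlMr; last by lra.
nra.
Qed.

Lemma normal_prob_moment2 : exists2 c : R, (0 <= c)%R &
  \int[normal_prob 0 1]_(x in [set: measurableTypeR R]) (x ^+ 2)%:E <= c%:E.
Proof.
(* From t <= exp t at t = x^2 / 4, x^2 exp(- x^2 / 2) <= 4 exp(- x^2 / 4), the shape of the density
   of N(0, 2); the factor sqrt 2 is the ratio of the normalizing constants. *)
exists (4 * Num.sqrt 2)%R; first by rewrite mulr_ge0.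
have s0 : (0 < Num.sqrt 2 :> R)%R by rewrite sqrtr_gt0.
have sq : (Num.sqrt 2 ^+ 2 = 2 :> R)%R by rewrite sqr_sqrtr.
have mx2 : measurable_fun setT (fun x : measurableTypeR R => (x ^+ 2)%:E).
  by apply/measurable_EFinP; exact: measurable_funX.
rewrite ge0_integral_normal_prob//; last by move=> x; rewrite lee_fin sqr_ge0.
have <- : \int[mu]_x ((4 * Num.sqrt 2)%:E * (normal_pdf 0 (Num.sqrt 2) x)%:E) =
    (4 * Num.sqrt 2)%:E.
  rewrite ge0_integralZl//.
  - by rewrite integral_normal_pdf mule1.
  - by apply/measurable_EFinP; exact: measurable_normal_pdf.
  - by move=> x _; rewrite lee_fin normal_pdf_ge0.
apply: ge0_le_integral => //.
- by move=> x _; rewrite -EFinM lee_fin mulr_ge0 ?sqr_ge0 ?normal_pdf_ge0.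
- by apply: emeasurable_funM => //; apply/measurable_EFinP;
    exact: measurable_normal_pdf.
- by apply: measurable_funeM; apply/measurable_EFinP; exact: measurable_normal_pdf.
move=> x _; rewrite -!EFinM lee_fin !normal_pdfE ?oner_eq0 ?gt_eqF//=.
rewrite /normal_fun /normal_peak subr0 expr1n sq.
have -> : (Num.sqrt (2 * pi *+ 2) = Num.sqrt 2 * Num.sqrt (1 * pi *+ 2) :> R)%R.
  by rewrite -sqrtrM//; congr Num.sqrt; ring.
rewrite invfM; set p := (Num.sqrt (1 * pi *+ 2))^-1%R.
have p0 : (0 <= p)%R by rewrite invr_ge0.
have -> : (4 * Num.sqrt 2 * ((Num.sqrt 2)^-1 * p * expR (- x ^+ 2 / (2 *+ 2))) =
   p * (4 * expR (- x ^+ 2 / (2 *+ 2))))%R by field; rewrite gt_eqF.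
rewrite mulrCA; apply: ler_wpM2l => //.
have -> : (- x ^+ 2 / (1 *+ 2) = - (x ^+ 2 / 4) + - (x ^+ 2 / 4))%R by field.
have -> : (- x ^+ 2 / (2 *+ 2) = - (x ^+ 2 / 4))%R by field.
rewrite expRD mulrA; apply: ler_wpM2r; first exact: expR_ge0.
rewrite expRN ler_pdivrMr ?expR_gt0//.
have := expR_ge1Dx (x ^+ 2 / 4); lra.
Qed.

Lemma normal_prob_itv_le (a b : R) : (a <= b)%R ->
  normal_prob 0 1 `[a, b]%classic <= (b - a)%:E.
Proof.
move=> ab; rewrite /normal_prob.
have mitv : measurable (`[a, b]%classic : set (measurableTypeR R)) by [].
apply: (@le_trans _ _ (\int[mu]_(x in `[a, b]%classic) 1)).
  apply: ge0_le_integral => //.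
  - by move=> x _; rewrite lee_fin normal_pdf_ge0.
  - by apply/measurable_EFinP; apply: measurable_funTS;
      exact: measurable_normal_pdf.
  move=> x _; rewrite lee_fin; apply: le_trans (normal_pdf_ub _ _ _) _.
    by rewrite oner_eq0.
  rewrite /normal_peak expr1n mul1r invf_le1; last first.
    by rewrite sqrtr_gt0 mulrn_wgt0// pi_gt0.
  rewrite -[X in (X <= _)%R](sqrtr1 R) ler_wsqrtr//.
  have := pi_ge2 R; rewrite mulr2n; lra.
rewrite integral_cst// mul1e /= lebesgue_measure_itv/= lte_fin.
by case: ifP => //; rewrite lee_fin subr_ge0.
Qed.

End gaussian.

(** * An integrable weight controlling inverse squares *)

Section spike.
Context {R : realType}.
Local Open Scope ereal_scope.

(* Integrable over R although its cube dominates y^-2. *)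
Definition spike_term (n : nat) (y : measurableTypeR R) : \bar R :=
  (4 ^+ n.+1 * \1_`[- 8 ^- n, 8 ^- n]%classic y)%:E.

Definition spike (y : measurableTypeR R) : \bar R := 1 + \sum_(n <oo) spike_term
    n y.

Lemma spike_term_ge0 n y : 0 <= spike_term n y.
Proof. by rewrite lee_fin mulr_ge0// exprn_ge0. Qed.

Lemma spike_ge1 y : 1 <= spike y.
Proof. by rewrite leeDl// nneseries_ge0// => n _ _; exact: spike_term_ge0. Qed.

Lemma spike_ge0 y : 0 <= spike y.
Proof. exact: le_trans (spike_ge1 y). Qed.

Lemma measurable_spike_term n : measurable_fun setT (spike_term n).
Proof.
by apply/measurable_EFinP; apply: measurable_funM => //; exact: measurable_indic.
Qed.

Lemma measurable_spike : measurable_fun setT spike.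
Proof.
apply: emeasurable_funD => //; apply: ge0_emeasurable_sum.
  by move=> n y _ _; exact: spike_term_ge0.
by move=> n _; exact: measurable_spike_term.
Qed.

Lemma le_spike (x y : R) : (`|x| <= `|y|)%R -> spike y <= spike x.
Proof.
move=> xy; rewrite leeD2l//; apply: lee_nneseries => [n _ _|n _].
  exact: spike_term_ge0.
rewrite lee_fin ler_wpM2l ?exprn_ge0// !indicE ler_nat.
case: (boolP (y \in _)) => //=; rewrite inE/= in_itv/= -ler_norml => yn.
by rewrite mem_set//= in_itv/= -ler_norml (le_trans xy).
Qed.

Lemma spike_ge_pow n (y : R) : (`|y| <= 8 ^- n)%R -> (4 ^+ n.+1)%:E <= spike y.
Proof.
move=> yn; have <- : spike_term n y = (4 ^+ n.+1)%:E.
  by rewrite /spike_term indicE mem_set ?mulr1//= in_itv/= -ler_norml.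
apply: (@le_trans _ _ (\sum_(0 <= i < n.+1) spike_term i y)).
  by rewrite big_nat_recr//= leeDr// sume_ge0// => i _; exact: spike_term_ge0.
rewrite -[X in X <= _]add0e leeD//.
by apply: nneseries_lim_ge => k _ _; exact: spike_term_ge0.
Qed.

(** The hypothesis encodes r <= y^-2 and allows every r at y = 0, where the series diverges. If
    8^-(n+1) < |y| <= 8^-n, then spike y >= 4^(n+1), whose cube is the square of 8^(n+1) and exceeds
    y^-2. The rates are tied by 4^3 = 8^2, while 4 < 8 gives integrability. *)
Lemma spike_cube (r y : R) : (r * y ^+ 2 <= 1)%R ->
  r%:E <= spike y * (spike y * spike y).
Proof.
have cube (c : R) : (0 <= c)%R -> c%:E <= spike y ->
    (c * (c * c))%:E <= spike y * (spike y * spike y).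
  by move=> c0 cy; rewrite !EFinM !lee_pmul// ?mule_ge0.
have [y0|y0] := eqVneq y 0%R.
  move=> _; pose n := Num.trunc r.
  have u1 : (1 <= 4 ^+ n.+1 :> R)%R by rewrite exprn_ege1// ler1n.
  have u0 : (0 <= 4 ^+ n.+1 :> R)%R by rewrite exprn_ge0.
  have := @spike_ge_pow n y; rewrite y0 normr0 invr_ge0 exprn_ge0// => /(_ isT).
  rewrite -y0 => /(cube _ u0); apply: le_trans; rewrite lee_fin.
  apply: (@le_trans _ _ (4 ^+ n.+1)%R).
    apply: le_trans (ltW (truncnS_gt r)) _; rewrite -natrX ler_nat.
    exact: ltnW (ltn_expl _ _).
  by rewrite ler_peMr// mulr_ege1.
have y20 : (0 < y ^+ 2)%R by rewrite exprn_even_gt0.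
rewrite -ler_pdivlMr// mul1r => ry; apply: (@le_trans _ _ ((y ^+ 2)^-1)%:E) => //.
have ny0 : (0 < `|y|)%R by rewrite normr_gt0.
have [y1|y1] := ltP 1%R (`|y|)%R.
  apply: le_trans (cube _ ler01 (spike_ge1 y)); rewrite lee_fin !mulr1.
  by rewrite -(real_normK (num_real y)) invf_le1 ?exprn_gt0// exprn_ege1// ltW.
have ex : exists n, (8 ^- n.+1 < `|y|)%R.
  pose n := Num.trunc (`|y|^-1)%R; exists n.
  rewrite invf_plt ?posrE ?exprn_gt0//.
  have : (`|y|^-1 < n.+1%:R)%R by exact: truncnS_gt.
  move/lt_le_trans; apply; rewrite -natrX ler_nat.
  exact: ltnW (ltn_expl _ _).
case: (ex_minnP ex) => n ny nmin.
have yn : (`|y| <= 8 ^- n)%R.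
  case: n {ny} nmin => [|n] nmin; first by rewrite expr0 invr1.
  by rewrite leNgt; apply/negP => /nmin; rewrite ltnn.
have := spike_ge_pow yn.
move/cube => /(_ (exprn_ge0 _ (ler0n _ _))); apply: le_trans.
rewrite lee_fin invf_ple ?posrE ?exprn_even_gt0 ?mulr_gt0 ?exprn_gt0//.
have <- : ((8 ^+ n.+1) ^+ 2 = 4 ^+ n.+1 * (4 ^+ n.+1 * 4 ^+ n.+1) :> R)%R.
  by rewrite exprAC -!exprMn; congr (_ ^+ _)%R; ring.
rewrite -exprVn -(real_normK (num_real y)) ler_sqr ?nnegrE ?invr_ge0 ?exprn_ge0//.
exact: ltW.
Qed.

(** [spike] decreases with the modulus, so each factor is at least its value at the argument of
    largest modulus, where [spike_cube] applies. A function of three variables is thus replaced by a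
    product, to be integrated factor by factor. *)
Lemma le_spike_prod (r a b c : R) :
  (0 <= r)%R -> (r * (a ^+ 2 + b ^+ 2 + c ^+ 2) <= 1)%R ->
  r%:E <= spike a * (spike b * spike c).
Proof.
move=> r0 rs; have [m [ma mb mc ms]] : exists m : R, [/\ (`|a| <= `|m|)%R, (`|b|
    <= `|m|)%R,
    (`|c| <= `|m|)%R & (m ^+ 2 <= a ^+ 2 + b ^+ 2 + c ^+ 2)%R].
  have a2 := sqr_ge0 a; have b2 := sqr_ge0 b; have c2 := sqr_ge0 c.
  have [ab|/ltW ab] := leP (`|a|)%R (`|b|)%R.
    have [bc|/ltW bc] := leP (`|b|)%R (`|c|)%R.
      by exists c; split=> //; [exact: le_trans bc|lra].
    by exists b; split=> //; lra.
  have [ac|/ltW ac] := leP (`|a|)%R (`|c|)%R.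
    by exists c; split=> //; [exact: le_trans ac|lra].
  by exists a; split=> //; lra.
apply: le_trans (spike_cube (le_trans (ler_wpM2l r0 ms) rs)) _.
apply: lee_pmul; [exact: spike_ge0| |exact: le_spike|].
  by rewrite mule_ge0 ?spike_ge0.
by apply: lee_pmul; rewrite ?spike_ge0 ?le_spike.
Qed.

(** The normal density is at most 1, so wherever the interval is centred, term n contributes at most
    4^(n+1) times the length 2 * 8^-n, that is 8 * 2^-n. These sum to 16, and the constant 1 gives
    17. *)
Lemma integral_spike_le (s : R) :
  \int[normal_prob 0 1]_x spike (translation s x) <= 17%:E.
Proof.
have mt n : measurable_fun setT (fun x => spike_term n (translation s x)).
  by apply: (measurableT_comp (measurable_spike_term n));
      exact: measurable_translation.
rewrite ge0_integralD//; first last.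
- apply: ge0_emeasurable_sum => [n x _ _|n _]; [exact: spike_term_ge0|exact: mt].
- by move=> x _; apply: nneseries_ge0 => n _ _; exact: spike_term_ge0.
rewrite integral_cst// [X in _ * X]probability_setT mule1.
rewrite integral_nneseries//; last by move=> n x _; exact: spike_term_ge0.
have -> : 17%:E = 1 + 16%:E :> \bar R by rewrite -EFinD; congr EFin; ring.
rewrite leeD2l//; apply: (@le_trans _ _ (\sum_(n <oo) (geometric 8 (2^-1) n :
    R)%:E)).
  apply: lee_nneseries => [n _ _|n _].
    by apply: integral_ge0 => x _; exact: spike_term_ge0.
  have -> : \int[normal_prob 0 1]_x spike_term n (translation s x) =
      \int[normal_prob 0 1]_x ((4 ^+ n.+1)%:E *
        (\1_`[- 8 ^- n - s, 8 ^- n - s]%classic x)%:E).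
    apply: eq_integral => x _; rewrite /spike_term EFinM !indicE.
    congr (_ * (nat_of_bool _)%:R%:E).
    by apply/idP/idP; rewrite !inE/= !in_itv/= /translation; lra.
  rewrite ge0_integralZl//; last by apply/measurable_EFinP; exact: measurable_indic.
  rewrite integral_indic// setIT.
  have r0 : (0 <= 8 ^- n :> R)%R by rewrite invr_ge0 exprn_ge0.
  apply: le_trans (lee_wpmul2l _ (normal_prob_itv_le _)) _.
  - by rewrite lee_fin exprn_ge0.
  - lra.
  rewrite -EFinM lee_fin /geometric/=.
  have -> : (8 ^- n = 4 ^- n * 2^-1 ^+ n :> R)%R.
    by rewrite -!exprVn -exprMn; congr (_ ^+ _)%R; field.
  rewrite exprS; have /(@mulfV R) : (4 ^+ n != 0 :> R)%R by rewrite expf_neq0.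
  set u := (4 ^+ n)%R; set v := (2^-1 ^+ n)%R => uE.
  have -> : (4 * u * (u^-1 * v - s - (- (u^-1 * v) - s)) = 8 * (u / u) * v)%R by
      ring.
  by rewrite uE mulr1.
have h := @cvg_geometric_series R 8 2^-1.
have /h : (`|2^-1| < 1 :> R)%R by rewrite ger0_norm// invf_lt1// ltr1n.
rewrite (_ : 8 / (1 - 2^-1) = 16 :> R)%R; last by field.
move=> cv; rewrite le_eqVlt; apply/orP; left; apply/eqP; apply/cvg_lim => //.
rewrite (_ : (fun n => _) = EFin \o series (geometric 8 2^-1)).
  by apply/fine_cvgP; split=> //; exact: nearW.
by apply/funext => n; rewrite /= /series/= sumEFin.
Qed.

End spike.

(** * Determinants of Gram matrices *)

Section gram_det.
Context {R : realType}.

(** Cauchy-Binet over all maps instead of subsets: a non-injective f contributes 0 and each d-subset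
    is counted d! times, so no ordering of columns is involved. Expanding one factor gives products
    of entries times minors; reindexing f by every permutation and summing rebuilds the second
    minor. *)
Lemma det_gram (d N : nat) (M : 'M[R]_(d, N)) :
  \det (M *m M^T) *+ d`! =
  \sum_(f : {ffun 'I_d -> 'I_N}) \det (colsub f M) ^+ 2.
Proof.
pose p (f : {ffun 'I_d -> 'I_N}) := \prod_i M i (f i).
have detE : \det (M *m M^T) =
    \sum_(f : {ffun 'I_d -> 'I_N}) p f * \det (colsub f M).
  rewrite /determinant.
  under eq_bigr => s _.
    under eq_bigr => i _ do rewrite !mxE.
    under eq_bigr => i _ do under eq_bigr => j _ do rewrite mxE.
    rewrite bigA_distr_bigA mulr_sumr/=.
    over.
  rewrite exchange_big/=; apply: eq_bigr => f _.
  rewrite -/(determinant _) -det_tr /determinant mulr_sumr; apply: eq_bigr => s _.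
  rewrite big_split/= mulrCA; congr (_ * (_ * _)).
  by apply: eq_bigr => i _; rewrite !mxE.
have detP (s : 'S_d) : \det (M *m M^T) = \sum_(f : {ffun 'I_d -> 'I_N})
    ((-1) ^+ s * \prod_i M i (f (s i))) * \det (colsub f M).
  pose h (f : {ffun 'I_d -> 'I_N}) := [ffun i => f (s i)].
  have hbij : bijective h.
    exists (fun f : {ffun 'I_d -> 'I_N} => [ffun i => f ((s^-1)%g i)]) => f;
      by apply/ffunP => i; rewrite !ffunE ?permK ?permKV.
  rewrite detE (reindex h) /=; last exact: onW_bij.
  apply: eq_bigr => f _; rewrite [_ * \prod_i _]mulrC -mulrA; congr (_ * _).
    by apply: eq_bigr => i _; rewrite ffunE.
  have -> : colsub (h f) M = col_perm s (colsub f M).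
    by apply/matrixP => i j; rewrite !mxE ffunE.
  by rewrite col_permE det_mulmx det_perm odd_permV mulrC.
have -> : \det (M *m M^T) *+ d`! = \sum_(s : 'S_d) \det (M *m M^T).
  by rewrite sumr_const card_Sn.
under eq_bigr => s _ do rewrite (detP s).
rewrite exchange_big/=; apply: eq_bigr => f _.
rewrite -mulr_suml expr2; congr (_ * _); rewrite /determinant.
by apply: eq_bigr => s _; congr (_ * _); apply: eq_bigr => i _; rewrite !mxE.
Qed.

Lemma det_gram_ge0 (d N : nat) (M : 'M[R]_(d, N)) : 0 <= \det (M *m M^T).
Proof.
rewrite -(pmulrn_lge0 _ (fact_gt0 d)) det_gram.
by apply: sumr_ge0 => f _; exact: sqr_ge0.
Qed.

Lemma det_gram_neq0 (d N : nat) (M : 'M[R]_(d, N)) (f : 'I_d -> 'I_N) :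
  \det (colsub f M) != 0 -> \det (M *m M^T) != 0.
Proof.
move=> D0; rewrite gt_eqF// -(pmulrn_lgt0 _ (fact_gt0 d)) det_gram.
rewrite (bigD1 (finfun f))//= ltr_pwDl//; last by apply: sumr_ge0 => g _;
    exact: sqr_ge0.
rewrite exprn_even_gt0//= (_ : colsub _ _ = colsub f M)//.
by apply/matrixP => i j; rewrite !mxE ffunE.
Qed.

End gram_det.

(** * Diagonal entries of the inverse of a Gram matrix *)

Section gram_inverse.
Context {R : realType} {d N : nat} (i : 'I_d.+1).
Implicit Types (M : 'M[R]_(d.+1, N)) (f : {ffun 'I_d -> 'I_N}).

Definition extend_cols (j : 'I_N) f : {ffun 'I_d.+1 -> 'I_N} :=
  [ffun l => if unlift i l is Some k then f k else j].

(** Cofactor of position (l, i) in the minor with columns [extend_cols j f]; column j is deleted in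
    it, so it is the same for all j. *)
Definition minor_coef M f (l : 'I_d.+1) : R :=
  (-1) ^+ (l + i) * \det (row' l (colsub f M)).

(* With minor_coef M f i != 0, the minor of M with columns j and f is, up to
   this factor, M i j + minor_shift M f j, where the shift does not involve the
   entries M i j with j outside the image of f. *)
Definition minor_shift M f j : R :=
  (\sum_(l | l != i) M l j * minor_coef M f l) / minor_coef M f i.

Lemma det_extend_cols M f j : minor_coef M f i != 0 ->
  \det (colsub (extend_cols j f) M) = minor_coef M f i * (M i j + minor_shift M f
      j).
Proof.
move=> c0; rewrite (expand_det_col _ i) (bigD1 i)//= mulrDr mulrC.
have cofE l : cofactor (colsub (extend_cols j f) M) l i = minor_coef M f l.
  rewrite /cofactor /minor_coef; congr (_ * \det _).
  by apply/matrixP => a b; rewrite !mxE ffunE liftK.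
rewrite cofE mxE ffunE unlift_none mulrC; congr (_ + _).
rewrite /minor_shift mulrCA divff// mulr1; apply: eq_bigr => l _.
by rewrite cofE mxE ffunE unlift_none.
Qed.

Lemma extend_cols_inj f : injective (extend_cols ^~ f).
Proof. by move=> j j' /ffunP/(_ i); rewrite !ffunE unlift_none. Qed.

Lemma minor_coefE M f : minor_coef M f i = \det (colsub f (row' i M)).
Proof.
rewrite /minor_coef addnn -signr_odd odd_double expr0 mul1r; congr (\det _).
by apply/matrixP => a b; rewrite !mxE.
Qed.

(** By Cramer's rule the entry is a quotient of determinants whose numerator is the Gram determinant
    of M without row i; [det_gram] expands it. *)
Lemma invmx_gram_diag M : M *m M^T \in unitmx ->
  invmx (M *m M^T) i i =
  (\sum_f minor_coef M f i ^+ 2 / \det (M *m M^T)) / d`!%:R.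
Proof.
move=> Wu; have := Wu; rewrite unitmxE unitfE => W0.
rewrite /invmx Wu !mxE /cofactor addnn -signr_odd odd_double expr0 mul1r.
have -> : row' i (col' i (M *m M^T)) = row' i M *m (row' i M)^T.
  by apply/matrixP => a b; rewrite !mxE; apply: eq_bigr => k _; rewrite !mxE.
rewrite -mulr_suml mulrC mulrAC; congr (_ / _).
apply: (@mulIf _ d`!%:R); first by rewrite pnatr_eq0 -lt0n fact_gt0.
rewrite divfK ?pnatr_eq0 -?lt0n ?fact_gt0// mulr_natr det_gram.
by apply: eq_bigr => f _; rewrite minor_coefE.
Qed.

(* The three minors with columns j1, j2, j3 added to f are among the terms of
   the expansion det_gram. *)
Lemma minor_ratio_le M f j1 j2 j3 : M *m M^T \in unitmx ->
  minor_coef M f i != 0 -> uniq [:: j1; j2; j3] ->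
  minor_coef M f i ^+ 2 / \det (M *m M^T) / d.+1`!%:R *
  ((M i j1 + minor_shift M f j1) ^+ 2 + (M i j2 + minor_shift M f j2) ^+ 2 +
   (M i j3 + minor_shift M f j3) ^+ 2) <= 1.
Proof.
move=> Wu c0 /= /and3P[]; rewrite !inE negb_or => /andP[j12 j13] j23 _.
have W0 : 0 < \det (M *m M^T).
  by rewrite lt_neqAle det_gram_ge0 eq_sym -unitfE -unitmxE Wu.
have assoc (x y z t : R) : x / y / z * t = x * t / (y * z).
  by rewrite invfM; ring.
rewrite assoc ler_pdivrMr ?mulr_gt0 ?ltr0n ?fact_gt0// mul1r.
rewrite mulr_natr det_gram.
rewrite (bigD1 (extend_cols j1 f))//= (bigD1 (extend_cols j2 f))/=; last first.
  by rewrite (inj_eq (@extend_cols_inj f)) eq_sym.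
rewrite (bigD1 (extend_cols j3 f))/=; last first.
  by rewrite !(inj_eq (@extend_cols_inj f)) ![j3 == _]eq_sym j13.
rewrite !det_extend_cols// !exprMn !addrA -!mulrDr lerDl.
by apply: sumr_ge0 => g _; exact: sqr_ge0.
Qed.

End gram_inverse.

(** * Gaussian matrices *)

Section gaussian_coordinates.
Context {R : realType} (n : nat).
Local Open Scope ereal_scope.
Local Notation T := (n.-tuple (measurableTypeR R)).
Local Notation law := (iid (normal_prob (0 : R) 1) n).

Lemma tnth_update (w : T) k x : tnth (tuple_update w k x) k = x.
Proof. by rewrite tnth_mktuple eqxx. Qed.

Lemma tnth_update_neq (w : T) k x i : i != k -> tnth (tuple_update w k x) i =
    tnth w i.
Proof. by move=> ik; rewrite tnth_mktuple (negbTE ik). Qed.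

Lemma measurable_spike_coordinate k (s : T -> measurableTypeR R) :
  measurable_fun setT s ->
  measurable_fun setT (fun w : T => spike (translation (s w) (tnth w k))).
Proof.
move=> ms; apply: (measurableT_comp measurable_spike).
by apply: measurable_funD => //; exact: measurable_tnth.
Qed.

(** Resample coordinate k: neither the shift nor G sees it, and the inner integral is at most 17
    whatever the value of the shift. *)
Lemma integral_spike_coordinate k (s : T -> measurableTypeR R) (G : T -> \bar R) :
  measurable_fun setT s -> measurable_fun setT G -> (forall w, 0 <= G w) ->
  (forall w x, s (tuple_update w k x) = s w) ->
  (forall w x, G (tuple_update w k x) = G w) ->
  \int[law]_w (spike (translation (s w) (tnth w k)) * G w) <= 17%:E * \int[law]_w
      G w.
Proof.
move=> ms mG G0 sk Gk.
have mS := measurable_spike_coordinate k ms.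
rewrite (ge0_integral_iid_update _ k); last 2 first.
- exact: emeasurable_funM.
- by move=> w; rewrite mule_ge0 ?spike_ge0.
rewrite -ge0_integralZl//.
have inner w : \int[normal_prob 0 1]_x (spike (translation (s (tuple_update w k x))
    (tnth (tuple_update w k x) k)) * G (tuple_update w k x)) <= 17%:E * G w.
  under eq_integral => x _ do rewrite sk Gk tnth_update.
  rewrite ge0_integralZr//; last 2 first.
  - by apply: (measurableT_comp measurable_spike); exact: measurable_translation.
  - by move=> x _; exact: spike_ge0.
  by apply: lee_wpmul2r => //; exact: integral_spike_le.
apply: ge0_le_integral => //.
- move=> w _; apply: integral_ge0 => x _; rewrite mule_ge0 ?spike_ge0//.
- have mf : measurable_fun setT (fun wx : T * measurableTypeR R =>
     spike (translation (s (tuple_update wx.1 k wx.2))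
    (tnth (tuple_update wx.1 k wx.2) k)) * G (tuple_update wx.1 k wx.2)).
    by apply: (measurableT_comp (emeasurable_funM mS mG));
        exact: measurable_tuple_update.
  apply: (@measurable_fun_fubini_tonelli_F _ _ _ _ _ (normal_prob 0 1) _ mf).
  by move=> wx; rewrite mule_ge0 ?spike_ge0.
- exact: measurable_funeM.
Qed.

Lemma integral_spike_prod3 k1 k2 k3 (s1 s2 s3 : T -> measurableTypeR R) :
  uniq [:: k1; k2; k3] ->
  measurable_fun setT s1 -> measurable_fun setT s2 -> measurable_fun setT s3 ->
  (forall s, s \in [:: s1; s2; s3] -> forall k, k \in [:: k1; k2; k3] ->
    forall w x, s (tuple_update w k x) = s w) ->
  \int[law]_w (spike (translation (s1 w) (tnth w k1)) *
    (spike (translation (s2 w) (tnth w k2)) * spike (translation (s3 w) (tnth w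
        k3))))
  <= (17 * (17 * 17))%:E.
Proof.
move=> /= /and3P[]; rewrite !inE negb_or => /andP[k12 k13] k23 _ m1 m2 m3 inv.
have inv1 := inv s1 (mem_head _ _).
have inv2 : forall k, k \in [:: k1; k2;
    k3] -> forall w x, s2 (tuple_update w k x) = s2 w.
  by apply: inv; rewrite !inE eqxx orbT.
have inv3 : forall k, k \in [:: k1; k2;
    k3] -> forall w x, s3 (tuple_update w k x) = s3 w.
  by apply: inv; rewrite !inE eqxx !orbT.
have M k s ms := @measurable_spike_coordinate k s ms.
have k1in : k1 \in [:: k1; k2; k3] by rewrite mem_head.
have k2in : k2 \in [:: k1; k2; k3] by rewrite !inE eqxx orbT.
have k3in : k3 \in [:: k1; k2; k3] by rewrite !inE eqxx !orbT.
apply: le_trans (integral_spike_coordinate m1 _ _ (inv1 _ k1in) _) _.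
- by apply: emeasurable_funM; exact: M.
- by move=> w; rewrite mule_ge0 ?spike_ge0.
- by move=> w x; rewrite inv2// inv3// !tnth_update_neq// eq_sym.
rewrite EFinM; apply: lee_wpmul2l => //.
apply: le_trans (integral_spike_coordinate m2 _ _ (inv2 _ k2in) _) _.
- exact: M.
- by move=> w; rewrite spike_ge0.
- by move=> w x; rewrite inv3// !tnth_update_neq// eq_sym.
rewrite EFinM; apply: lee_wpmul2l => //.
have := @integral_spike_coordinate k3 s3 (cst 1) m3 (measurable_cst _)
  (fun=> lee01) (inv3 _ k3in) (fun _ _ => erefl).
under eq_integral do rewrite mule1.
by rewrite integral_cst// [X in 1 * X]probability_setT !mule1.
Qed.

(** With the other coordinates frozen and a nonzero, a single value of coordinate k is a root, and
    points are null for the normal law. *)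
Lemma affine_coordinate_neq0_ae k (a b : T -> measurableTypeR R) :
  measurable_fun setT a -> measurable_fun setT b ->
  (forall w x, a (tuple_update w k x) = a w) ->
  (forall w x, b (tuple_update w k x) = b w) ->
  law [set w | a w = 0%R] = 0 ->
  law [set w | (tnth w k * a w + b w)%R = 0%R] = 0.
Proof.
move=> ma mb ak bk a0.
have mzero (f : T -> measurableTypeR R) : measurable_fun setT f ->
    measurable [set w | f w = 0%R].
  by move=> mf; rewrite -[X in measurable X]setTI;
      exact: (mf measurableT [set 0%R] (measurable_set1 _)).
pose F : T -> measurableTypeR R := fun w => (tnth w k * a w + b w)%R.
have mF : measurable_fun setT F.
  apply: measurable_funD => //; apply: measurable_funM => //;
      exact: measurable_tnth.
pose f w : \bar R := (\1_[set w | F w = 0%R] w)%:E.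
have mf : measurable_fun setT f.
  by apply/measurable_EFinP; apply: measurable_indic; exact: mzero.
have f0 w : 0 <= f w by rewrite lee_fin.
have <- : \int[law]_w f w = law [set w | F w = 0%R].
  by rewrite integral_indic ?setIT//; exact: mzero.
rewrite (ge0_integral_iid_update _ k)//; apply/eqP; rewrite eq_le.
rewrite integral_ge0 ?andbT//; last by move=> w _; exact: integral_ge0.
rewrite -a0 -(setIT [set w | a w = 0%R]) -integral_indic//; last exact: mzero.
apply: ge0_le_integral => //.
- by move=> w _; exact: integral_ge0.
- have mfu : measurable_fun setT (fun wx : T * measurableTypeR R =>
     f (tuple_update wx.1 k wx.2)).
    by apply: (measurableT_comp mf); exact: measurable_tuple_update.
  exact: (@measurable_fun_fubini_tonelli_F _ _ _ _ _ (normal_prob 0 1) _ mfu).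
- by apply/measurable_EFinP; apply: measurable_indic; exact: mzero.
move=> w _; have [aw|aw] := eqVneq (a w) 0%R.
  rewrite [leRHS]/= indicE mem_set//;
      apply: (@le_trans _ _ (\int[normal_prob 0 1]_x 1)).
    apply: ge0_le_integral => //.
      have mfu : measurable_fun setT (fun x : measurableTypeR R => (w, x)).
        exact: pair1_measurable.
      apply: (measurableT_comp mf).
      exact: (measurableT_comp (measurable_tuple_update k) mfu).
    by move=> x _; rewrite /f lee_fin indicE lern1 leq_b1.
  by rewrite integral_cst// [X in 1 * X]probability_setT mule1.
rewrite [leRHS]/= indicE memNset; last by apply/eqP.
have -> : \int[normal_prob 0 1]_x f (tuple_update w k x) =
    \int[normal_prob 0 1]_x (\1_[set (- b w / a w)%R] x)%:E.
  apply: eq_integral => x _; rewrite /f !indicE; congr (nat_of_bool _)%:R%:E.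
  apply/idP/idP; rewrite !inE/= /F ak bk tnth_update.
    by move/eqP; rewrite addr_eq0 => /eqP <-; rewrite mulfK.
  by move=> ->; rewrite divfK// addNr.
rewrite integral_indic// setIT.
have /null_content_dominatesP dom := @normal_prob_dominates R 0 1.
rewrite [leLHS](_ : _ = 0)//; apply: dom => //; exact: lebesgue_measure_set1.
Qed.

End gaussian_coordinates.

(** Entries of row i outside the columns of f do not enter the shift; these are the coordinates that
    get integrated. *)
Lemma eq_minor_shift (R : realType) d N (i : 'I_d.+1) (M M' : 'M[R]_(d.+1, N))
    (f : {ffun 'I_d -> 'I_N}) j :
  (forall l b, l != i -> M l b = M' l b) ->
  (forall l b, M l (f b) = M' l (f b)) ->
  minor_shift i M f j = minor_shift i M' f j.
Proof.
move=> row_eq col_eq.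
have coef_eq l : minor_coef i M f l = minor_coef i M' f l.
  rewrite /minor_coef; congr (_ * \det _).
  by apply/matrixP => a b; rewrite !mxE col_eq.
rewrite /minor_shift coef_eq; congr (_ / _).
by apply: eq_bigr => l li; rewrite row_eq// coef_eq.
Qed.

(** f occupies at most d of the N columns. Here d is the matrix dimension minus one, so three free
    columns amount to N being at least the dimension plus 2. *)
Lemma exists_three_avoiding d N (f : {ffun 'I_d -> 'I_N}) : (d.+3 <= N)%N ->
  exists j : 'I_N * 'I_N * 'I_N, uniq [:: j.1.1; j.1.2; j.2] /\
    forall k, k \in [:: j.1.1; j.1.2; j.2] -> forall b, f b != k.
Proof.
move=> dN; pose C := [set k | [forall b, f b != k]]%SET.
have : (2 < #|C|)%N.
  have -> : C = (~: [set f b | b : 'I_d])%SET.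
    apply/setP => k; rewrite !inE; apply/forallP/negP => [h /imsetP[b _ kE]|h b].
      by have := h b; rewrite kE eqxx.
    by apply/eqP => fb; apply: h; apply/imsetP; exists b.
  rewrite cardsCs finset.setCK card_ord; have := leq_imset_card f 'I_d.
  by rewrite card_ord => h; rewrite ltn_subRL addnC; apply: leq_trans dN;
      rewrite addnC !addnS addn0 !ltnS.
move=> /card_gt2P[j1 [j2 [j3 [[h1 h2 h3] [n12 n23 n31]]]]].
exists (j1, j2, j3); split => /=.
  by rewrite !inE negb_or n12 n23 eq_sym n31.
move=> k; rewrite !inE => /or3P[]/eqP-> b; [move: h1|move: h2|move: h3];
  by rewrite inE => /forallP.
Qed.

Lemma uncurry_mxvec_index_inj (p q : nat) : injective (uncurry (@mxvec_index p q)).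
Proof.
have [g gK _] := curry_mxvec_bij p q.
by move=> x y xy; rewrite -(gK x)// xy gK.
Qed.

Section gaussian_matrix.
Context {R : realType} (d N : nat).
Local Notation T := ((d.+1 * N).-tuple (measurableTypeR R)).
Local Notation law := (@noise_law R d.+1 N).
Variable m : 'M[R]_(d.+1, N).

Definition shifted_gauss_mx (w : T) : 'M[R]_(d.+1, N) := m + gauss_mx w.

Local Notation M := shifted_gauss_mx.

Lemma shifted_gauss_mxE w i j : M w i j = tnth w (mxvec_index i j) + m i j.
Proof. by rewrite !mxE addrC. Qed.

Lemma shifted_gauss_mx_update w i j x a b : (a, b) != (i, j) ->
  M (tuple_update w (mxvec_index i j) x) a b = M w a b.
Proof.
move=> abij; rewrite !shifted_gauss_mxE tnth_update_neq//.
have inj := @uncurry_mxvec_index_inj d.+1 N.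
by rewrite (inj_eq inj (a, b) (i, j)).
Qed.

Lemma measurable_shifted_gauss_mx : measurable_mx M.
Proof.
move=> i j; under eq_fun do rewrite shifted_gauss_mxE.
by apply: measurable_funD => //; exact: measurable_tnth.
Qed.

Lemma measurable_minor_shift i (f : {ffun 'I_d -> 'I_N}) j :
  measurable_fun setT (fun w => minor_shift i (M w) f j : measurableTypeR R).
Proof.
have mcoef l : measurable_fun setT (fun w => minor_coef i (M w) f l :
    measurableTypeR R).
  apply: measurable_funM => //; apply: measurable_det => a b.
  rewrite [X in measurable_fun _ X](_ : _ = fun w => M w (lift l a) (f b)).
    exact: measurable_shifted_gauss_mx.
  by apply/funext => w; rewrite !mxE.
apply: measurable_funM; last exact: measurable_fun_inv.
under eq_fun do rewrite -big_filter.
apply: measurable_sum => l; apply: measurable_funM; last exact: mcoef.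
exact: measurable_shifted_gauss_mx.
Qed.

(** The bound on the mean of h involves only d and N, not m, hence is uniform over all Wishart
    means. Domination is claimed only for an invertible Gram matrix, as [invmx] returns its argument
    otherwise. *)
Lemma gram_inverse_trace_bound : (d.+3 <= N)%N ->
  exists h : T -> \bar R, [/\ measurable_fun setT h, forall w, (0 <= h w)%E,
    (\int[law]_w h w <=
      (d.+1%:R * \sum_(i < d.+1) \sum_(f : {ffun 'I_d -> 'I_N}) (17 * (17 *
          17)))%:E)%E &
    forall w, M w *m (M w)^T \in unitmx ->
      ((\tr (invmx (M w *m (M w)^T)))%:E <= h w)%E].
Proof.
move=> dN.
have [J HJ] := fin_all_exists (fun f : {ffun 'I_d -> 'I_N} =>
    exists_three_avoiding f dN).
pose s i f j w : measurableTypeR R := m i j + minor_shift i (M w) f j.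
have ms i f j : measurable_fun setT (s i f j).
  by apply: measurable_funD => //; exact: measurable_minor_shift.
pose g i f j w := spike (translation (s i f j w) (tnth w (mxvec_index i j))).
have mg i f j : measurable_fun setT (g i f j) by exact: measurable_spike_coordinate.
have g0 i f j w : (0 <= g i f j w)%E by exact: spike_ge0.
pose G i f w := (g i f (J f).1.1 w * (g i f (J f).1.2 w * g i f (J f).2 w))%E.
have mG i f : measurable_fun setT (G i f).
  by apply: emeasurable_funM => //; exact: emeasurable_funM.
have G0 i f w : (0 <= G i f w)%E by rewrite !mule_ge0.
exists (fun w => (d.+1%:R%:E * \sum_(i < d.+1) \sum_(f : {ffun 'I_d -> 'I_N}) G i
    f w)%E).
have mS i : measurable_fun setT (fun w => \sum_(f : {ffun 'I_d -> 'I_N}) G i f w)%E.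
  by apply: emeasurable_sum => f.
have S0 i w : (0 <= \sum_(f : {ffun 'I_d -> 'I_N}) G i f w)%E by exact: sume_ge0.
split.
- by apply: measurable_funeM; apply: emeasurable_sum => i.
- by move=> w; rewrite mule_ge0// sume_ge0.
- rewrite ge0_integralZl//; last 2 first.
  + by apply: emeasurable_sum => i.
  + by move=> w _; rewrite sume_ge0.
  rewrite EFinM; apply: lee_wpmul2l => //.
  rewrite ge0_integral_sum// -sumEFin; apply: lee_sum => i _.
  rewrite ge0_integral_sum// -sumEFin; apply: lee_sum => f _.
  have [uJ fJ] := HJ f.
  have inj := @uncurry_mxvec_index_inj d.+1 N.
  have inji : injective (@mxvec_index d.+1 N i).
    by move=> a b /(inj (i, a) (i, b))[].
  apply: integral_spike_prod3 => //; first by rewrite -(map_inj_uniq inji) in uJ.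
  move=> s' s'in k kin w x.
  have {kin} [j jin ->] : exists2 j, j \in [:: (J f).1.1; (J f).1.2; (J f).2] &
      k = mxvec_index i j by apply/mapP; rewrite kin.
  have {s'in} [j' ->] : exists j', s' = s i f j'.
    by move: s'in; rewrite !inE => /or3P[]/eqP->; eexists.
  rewrite /s; congr (_ + _); apply: eq_minor_shift => [l b li|l b].
    by rewrite shifted_gauss_mx_update// xpair_eqE negb_and li.
  by rewrite shifted_gauss_mx_update// xpair_eqE negb_and (fJ _ jin) orbT.
move=> w Wu; rewrite /mxtrace -sumEFin ge0_sume_distrr//.
apply: lee_sum => i _; rewrite invmx_gram_diag// mulr_suml -sumEFin
    ge0_sume_distrr//.
apply: lee_sum => f _.
have W0 : 0 < \det (M w *m (M w)^T).
  by rewrite lt_neqAle det_gram_ge0 eq_sym -unitfE -unitmxE Wu.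
set r := minor_coef i (M w) f i ^+ 2 / \det (M w *m (M w)^T) / d.+1`!%:R.
(* The expansion of the inverse carries d! and [minor_ratio_le] carries (d + 1)!; their quotient is
   the factor d + 1 in h. *)
have -> : minor_coef i (M w) f i ^+ 2 / \det (M w *m (M w)^T) / d`!%:R = d.+1%:R
    * r.
  by rewrite /r factS natrM invfM; field; rewrite !gt_eqF ?ltr0n ?fact_gt0.
rewrite EFinM; apply: lee_wpmul2l => //.
(* If the coefficient vanishes, so does r, and the shift, then a division by zero, is harmless. *)
have [c0|c0] := eqVneq (minor_coef i (M w) f i) 0.
  by rewrite /r c0 expr0n/= !mul0r.
have [uJ _] := HJ f; apply: le_spike_prod.
  by rewrite !divr_ge0 ?sqr_ge0// ltW.
have := minor_ratio_le Wu c0 uJ; rewrite -/r.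
by rewrite /translation /s !shifted_gauss_mxE !addrA.
Qed.

End gaussian_matrix.

(** * Almost sure nonsingularity of Gaussian Gram matrices *)

Section gaussian_nonsingular.
Context {R : realType} (d N : nat).
Local Notation T := ((d.+1 * N.+1).-tuple (measurableTypeR R)).
Local Notation law := (@noise_law R d.+1 N.+1).
Variable m : 'M[R]_(d.+1, N.+1).
Hypothesis dN : (d <= N)%N.
Local Notation M := (shifted_gauss_mx m).

(** [inord] lets k be a plain natural number in the induction; the entries are the intended ones
    while k <= d + 1, since d <= N. *)
Definition leading_mx k (w : T) : 'M[R]_k :=
  \matrix_(i < k, j < k) M w (inord i) (inord j).

Lemma measurable_leading_mx k : measurable_mx (leading_mx k).
Proof.
by move=> i j; under eq_fun do rewrite mxE; exact: measurable_shifted_gauss_mx.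
Qed.

(* Expanding along the last row, the minor of size k.+1 is affine in its last
   diagonal entry, with the minor of size k as slope. *)
Lemma leading_minor_neq0_ae k : (k <= d.+1)%N ->
  law [set w | \det (leading_mx k w) = 0] = 0%E.
Proof.
elim: k => [_|k ih kd].
  rewrite (_ : [set w | _] = set0) ?measure0// -subset0 => w /=.
  by rewrite det_mx00 => /eqP; rewrite oner_eq0.
pose i0 : 'I_d.+1 := inord k; pose j0 : 'I_N.+1 := inord k.
have valL (i : 'I_k.+1) : (inord i : 'I_d.+1) = i :> nat.
  by rewrite inordK//; exact: leq_trans (ltn_ord i) kd.
have valR (i : 'I_k.+1) : (inord i : 'I_N.+1) = i :> nat.
  by rewrite inordK//; apply: leq_trans (ltn_ord i) _; exact: leq_trans kd _.
have upd w x (i j : 'I_k.+1) : (i != ord_max) || (j != ord_max) ->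
    M (tuple_update w (mxvec_index i0 j0) x) (inord i) (inord j) =
    M w (inord i) (inord j).
  move=> ij; rewrite shifted_gauss_mx_update//; apply/negP => /eqP[Ei Ej].
  case/orP: ij => /eqP; apply; apply/val_inj.
    exact: etrans (esym (valL i)) (etrans (congr1 val Ei) (valL ord_max)).
  exact: etrans (esym (valR j)) (etrans (congr1 val Ej) (valR ord_max)).
have det_upd w x : \det (leading_mx k (tuple_update w (mxvec_index i0 j0) x)) =
    \det (leading_mx k w).
  congr (\det _); apply/matrixP => i j; rewrite [LHS]mxE [RHS]mxE.
  have := @upd w x (lift ord_max i) (lift ord_max j).
  by rewrite !lift_max; apply; rewrite eq_sym neq_lift.
pose b w := \sum_(j < k.+1 | j != ord_max)
  M w i0 (inord j) * cofactor (leading_mx k.+1 w) ord_max j.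
have cofE w : cofactor (leading_mx k.+1 w) ord_max ord_max = \det (leading_mx k w).
  rewrite /cofactor addnn -signr_odd odd_double expr0 mul1r; congr (\det _).
  by apply/matrixP => i j; rewrite !mxE !lift_max.
have detE w : \det (leading_mx k.+1 w) =
    tnth w (mxvec_index i0 j0) * \det (leading_mx k w) +
    (m i0 j0 * \det (leading_mx k w) + b w).
  rewrite (expand_det_row _ ord_max) (bigD1 ord_max)//= cofE.
  rewrite mxE /= shifted_gauss_mxE -/i0 -/j0 mulrDl -addrA; congr (_ + (_ + _)).
  by apply: eq_bigr => j _; rewrite mxE.
have mdet l : measurable_fun setT (fun w => \det (leading_mx l w) :
    measurableTypeR R).
  by apply: measurable_det; exact: measurable_leading_mx.
under eq_set do rewrite detE.
apply: affine_coordinate_neq0_ae => //.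
- apply: measurable_funD; first by apply: measurable_funM;
    [exact: measurable_cst|exact: mdet].
  rewrite /b; under eq_fun do rewrite -big_filter.
  apply: measurable_sum => j; apply: measurable_funM.
    exact: measurable_shifted_gauss_mx.
  apply: measurable_funM => //; apply: measurable_det => p q.
  rewrite [X in measurable_fun _ X](_ : _ = fun w => M w (inord (lift ord_max p))
      (inord (lift j q))).
    exact: measurable_shifted_gauss_mx.
  by apply/funext => w; rewrite !mxE.
- move=> w x; rewrite det_upd; congr (_ + _).
  rewrite /b; apply: eq_bigr => j jm; congr (_ * _).
    by have := @upd w x ord_max j; rewrite jm orbT => ->.
  congr (_ * \det _); apply/matrixP => p q.
  do 3 rewrite [LHS]mxE [RHS]mxE.
  by apply: upd; rewrite eq_sym neq_lift.
- by apply: ih; exact: ltnW.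
Qed.

Lemma gram_nonsingular_ae :
  law [set w | \det (M w *m (M w)^T) = 0] = 0%E.
Proof.
have mW : measurable_mx (fun w => M w *m (M w)^T).
  apply: measurable_mxM; first exact: measurable_shifted_gauss_mx.
  by apply: measurable_mxT; exact: measurable_shifted_gauss_mx.
have mzero k (f : T -> 'M[R]_k) : measurable_mx f -> measurable [set w | \det (f
    w) = 0].
  move=> /measurable_det mf; rewrite -[X in measurable X]setTI.
  exact: (mf measurableT [set 0] (measurable_set1 _)).
apply/eqP; rewrite eq_le measure_ge0 andbT -(leading_minor_neq0_ae (leqnn d.+1)).
rewrite le_measure ?inE//; [exact: mzero|apply: mzero;
    exact: measurable_leading_mx|].
move=> w /=; apply: contraPP => /eqP D0; apply/eqP.
apply: (@det_gram_neq0 _ _ _ _ (fun i : 'I_d.+1 => inord i)).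
rewrite (_ : colsub _ _ = leading_mx d.+1 w)//.
by apply/matrixP => i j; rewrite !mxE inord_val.
Qed.

End gaussian_nonsingular.

(** * Positive definite matrices and the Riccati map *)

Section definite_matrices.
Context {R : realType}.

Lemma posdefmx_unit d (P : 'M[R]_d) : posdefmx P -> P \in unitmx.
Proof.
move=> [_ Ppos]; rewrite -row_free_unit -kermx_eq0.
apply/negPn/negP => /rowV0Pn[v /sub_kermxP vP v0].
by have := Ppos v v0; rewrite vP mul0mx mxE ltxx.
Qed.

Lemma psdmx_congr m n (C : 'M[R]_(m, n)) P : psdmx P -> psdmx (C *m P *m C^T).
Proof.
move=> [PT P0]; split; first by rewrite !trmx_mul trmxK PT mulmxA.
by move=> v; have := P0 (v *m C); rewrite trmx_mul !mulmxA.
Qed.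

Lemma psdmxD_posdef n (P Q : 'M[R]_n) : psdmx P -> posdefmx Q -> posdefmx (P + Q).
Proof.
move=> [PT P0] [QT Q0]; split; first by rewrite linearD/= PT QT.
by move=> v v0; rewrite mulmxDr mulmxDl mxE ltr_wpDl ?P0 ?Q0.
Qed.

Lemma posdefmx_psd n (P : 'M[R]_n) : posdefmx P -> psdmx P.
Proof.
move=> [PT P0]; split => // v; have [->|v0] := eqVneq v 0.
  by rewrite !mul0mx mxE.
exact/ltW/P0.
Qed.

Lemma delta_quad n (P : 'M[R]_n) i j :
  ((delta_mx 0 i : 'rV_n) *m P *m (delta_mx 0 j : 'rV_n)^T) 0 0 = P i j.
Proof. by rewrite -rowE trmx_delta -colE !mxE. Qed.

Lemma psdmx_diag_ge0 n (P : 'M[R]_n) i : psdmx P -> 0 <= P i i.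
Proof. by move=> [_ P0]; rewrite -delta_quad. Qed.

Lemma psdmx_trace_ge0 n (P : 'M[R]_n) : psdmx P -> 0 <= \tr P.
Proof. by move=> P0; apply: sumr_ge0 => i _; exact: psdmx_diag_ge0. Qed.

(** The form is nonnegative at e_i + e_j and at e_i - e_j, so |P i j| <= (P i i + P j j) / 2. *)
Lemma psdmx_entry_le n (P : 'M[R]_n) i j : psdmx P -> `|P i j| <= \tr P.
Proof.
move=> hP; have [PT P0] := hP.
have Pji : P j i = P i j by rewrite -[in LHS]PT mxE.
have [->|ij] := eqVneq i j.
  rewrite ger0_norm ?psdmx_diag_ge0// /mxtrace (bigD1 j)//= lerDl.
  by apply: sumr_ge0 => k _; exact: psdmx_diag_ge0.
have tr2 : P i i + P j j <= \tr P.
  rewrite /mxtrace (bigD1 i)//= (bigD1 j)/= 1?eq_sym// addrA lerDl.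
  by apply: sumr_ge0 => k _; exact: psdmx_diag_ge0.
have quad (c : R) : 0 <= P i i + c * P i j + c * P i j + c * c * P j j.
  have := P0 (delta_mx 0 i + c *: delta_mx 0 j).
  rewrite linearD/= linearZ/= !mulmxDl !mulmxDr -!scalemxAl -!scalemxAr scalerA
      addrA.
  have entries (X Y Z W : 'M[R]_1) : (X + c *: Y + c *: Z + (c * c) *: W) 0 0 =
      X 0 0 + c * Y 0 0 + c * Z 0 0 + c * c * W 0 0 by rewrite !mxE.
  by rewrite entries !delta_quad Pji.
have := quad 1; have := quad (-1); rewrite ler_norml => q1 q2.
by have := psdmx_diag_ge0 i hP; have := psdmx_diag_ge0 j hP; lra.
Qed.

(** A crude entrywise estimate: bound |C i j| |C i k| by the mean of the squares and the entries of
    P by [psdmx_entry_le]; the factor n counts the free index of the double sum. What matters later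
    is linearity in the trace of P. *)
Lemma trace_congr_le m n (C : 'M[R]_(m, n)) P : psdmx P ->
  \tr (C *m P *m C^T) <= n%:R * \tr (C *m C^T) * \tr P.
Proof.
move=> hP; have t0 := psdmx_trace_ge0 hP.
have entry_le k l := psdmx_entry_le k l hP;
    move: (\tr P) t0 entry_le => t t0 entry_le.
rewrite /mxtrace mulr_sumr mulr_suml; apply: ler_sum => i _.
rewrite !mxE mulr_sumr mulr_suml.
apply: (@le_trans _ _ (\sum_k \sum_j (C i j ^+ 2 + C i k ^+ 2) / 2 * t)).
  apply: ler_sum => k _; rewrite !mxE mulr_suml; apply: ler_sum => j _.
  rewrite mulrAC; apply: le_trans (ler_norm _) _; rewrite normrM.
  apply: ler_pM => //.
  rewrite normrM ler_pdivlMr//; have := sqr_ge0 (`|C i j| - `|C i k|).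
  by rewrite sqrrB !real_normK ?num_real//; lra.
under eq_bigr => k _ do rewrite -mulr_suml -mulr_suml.
rewrite -[leRHS]mulr_suml -[leLHS]mulr_suml; apply: ler_wpM2r => //.
rewrite -mulr_suml -mulr_sumr.
under eq_bigr => k _ do rewrite big_split/= sumr_const card_ord.
rewrite big_split/= sumr_const card_ord sumrMnl.
under [in leRHS]eq_bigr => j _ do rewrite mxE -expr2.
by rewrite -mulr_natl; set s := \sum_(j < n) _; lra.
Qed.

Lemma trace_gramD_le m n (X Y : 'M[R]_(m, n)) :
  \tr ((X + Y) *m (X + Y)^T) <= 2 * \tr (X *m X^T) + 2 * \tr (Y *m Y^T).
Proof.
have := psdmx_trace_ge0 (psdmx_gram (X - Y)).
rewrite !linearD/= linearN/= !(mulmxDl, mulmxDr, mulNmx, mulmxN) !mxtraceD.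
by rewrite !linearN/= opprK; lra.
Qed.

End definite_matrices.

(** * The Kalman update *)

Section riccati.
Context {R : realType} {d d0 : nat}.
Variables (B : 'M[R]_(d0, d)) (R0 : 'M[R]_d0).
Hypotheses (hR0 : posdefmx R0) (hS : posdefmx (B^T *m invmx R0 *m B)).
Local Notation S := (B^T *m invmx R0 *m B).

(* K |-> (I - K B) P (I - K B)' + K R0 K' is minimal at the Kalman gain; its
   value at the left inverse S^-1 B' R0^-1 of B is S^-1. *)
Lemma trace_update_le (P : 'M[R]_d) : psdmx P ->
  \tr (Ahat B R0 P *m P *m (Ahat B R0 P)^T) + \tr (Rhat B R0 P) <= \tr (invmx S).
Proof.
move=> hP; have [PT _] := hP; have [R0T _] := hR0; have [ST _] := hS.
pose G := B *m P *m B^T + R0.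
have hG : posdefmx G by apply: psdmxD_posdef => //; exact: psdmx_congr.
have [GT _] := hG; have Gu := posdefmx_unit hG.
have R0u := posdefmx_unit hR0; have Su := posdefmx_unit hS.
pose F K := (1%:M - K *m B) *m P *m (1%:M - K *m B)^T + K *m R0 *m K^T.
have FE K : F K = P - K *m B *m P - P *m B^T *m K^T + K *m G *m K^T.
  rewrite /F /G linearB/= trmx1 trmx_mul !(mulmxBl, mulmxBr, mulmxDl, mulmxDr).
  rewrite !mul1mx !mulmx1 !mulNmx !mulmxA.
  move: (K *m B *m P) (P *m B^T *m K^T) (K *m B *m P *m B^T *m K^T) (K *m R0 *m
      K^T).
  by move=> X1 X2 X3 X4; apply/matrixP => i j; rewrite !mxE; ring.
pose K0 := gain B R0 P; pose K1 := invmx S *m B^T *m invmx R0.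
have K0G : K0 *m G = P *m B^T by rewrite /K0 /gain -/G mulmxKV.
have GK0 : G *m K0^T = B *m P by rewrite -[G]GT -trmx_mul K0G trmx_mul trmxK PT.
have F1 : F K1 = invmx S.
  rewrite /F (_ : K1 *m B = 1%:M); last first.
    by rewrite /K1 -!mulmxA (mulmxA B^T) mulVmx.
  rewrite subrr !mul0mx add0r /K1 mulmxKV// !trmx_mul !trmx_inv trmxK R0T ST.
  have SV : B^T *m (invmx R0 *m (B *m invmx S)) = 1%:M by rewrite !mulmxA mulmxV.
  by move: (invmx S) SV => Si SV; rewrite -!mulmxA SV mulmx1.
have -> : \tr (Ahat B R0 P *m P *m (Ahat B R0 P)^T) + \tr (Rhat B R0 P) = \tr (F
    K0).
  by rewrite /F mxtraceD.
rewrite -F1 -subr_ge0 -linearB/=.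
(* Completing the square: [K0 *m G = P *m B^T] makes the terms linear in K1 - K0 cancel and leaves
   the form of G. *)
have -> : F K1 - F K0 = (K1 - K0) *m G *m (K1 - K0)^T.
  rewrite !FE linearB/= !(mulmxBl, mulmxBr) K0G -[K1 *m G *m K0^T]mulmxA GK0.
  have -> : K0 *m B *m P = P *m B^T *m K0^T.
    by rewrite -K0G -!mulmxA GK0.
  rewrite !mulmxA.
  move: (K1 *m B *m P) (P *m B^T *m K1^T) (K1 *m G *m K1^T) (P *m B^T *m K0^T).
  by move=> X1 X2 X3 X4; apply/matrixP => i j; rewrite !mxE; ring.
by apply/psdmx_trace_ge0/psdmx_congr/posdefmx_psd.
Qed.

End riccati.

(** * Wishart laws *)

Section trace_lyap_measurable.
Context {R : realType} {d : nat}.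

Lemma measurable_psd_trace :
  measurable_fun setT (fun p : psd R d => (\tr (psd_mx p))%:E).
Proof.
apply/measurable_EFinP; apply: measurable_sum => i; exact: measurable_psd_mx.
Qed.

Lemma measurable_lyap : measurable_fun setT (@lyap R d).
Proof.
have mdet : measurable_fun setT (fun p : psd R d => \det (psd_mx p) :
    measurableTypeR R).
  by apply: measurable_det; exact: measurable_psd_mx.
rewrite (_ : @lyap R d = fun p => if \det (psd_mx p) == 0 then +oo%E
   else (1 + \tr (psd_mx p) + \tr (invmx (psd_mx p)))%:E).
  apply: measurable_fun_ifT => //.
    by apply: measurable_fun_eqr => //; exact: measurable_cst.
  apply/measurable_EFinP; apply: measurable_funD.
    by apply: measurable_funD => //; apply: measurable_sum => i;
        exact: measurable_psd_mx.
  apply: measurable_sum => i; apply: (measurable_invmx (@measurable_psd_mx R d)).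
by apply/funext => p; rewrite /lyap unitmxE unitfE; case: eqP.
Qed.

Lemma psdmx_inv (P : 'M[R]_d) : psdmx P -> P \in unitmx -> psdmx (invmx P).
Proof.
move=> hP Pu; have [PT _] := hP.
have <- : invmx P *m P *m (invmx P)^T = invmx P.
  by rewrite mulVmx// mul1mx trmx_inv PT.
exact: psdmx_congr.
Qed.

Lemma lyap_ge1 (p : psd R d) : (1 <= lyap p)%E.
Proof.
rewrite /lyap; case: ifP => [pu|_]; last by rewrite leey.
rewrite lee_fin -addrA lerDl addr_ge0//; first exact: psdmx_trace_ge0 (psd_mxP p).
exact: psdmx_trace_ge0 (psdmx_inv (psd_mxP p) pu).
Qed.

End trace_lyap_measurable.

Section wishart_moments.
Context {R : realType} {d N : nat}.
Local Notation T := ((d * N).-tuple (measurableTypeR R)).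
Local Notation law := (@noise_law R d N).

Lemma measurable_scaled_wishart_mx (Om Sg : 'M[R]_d) :
  measurable_fun setT (fun w : T => psd_divN N (wishart_mx Om Sg w)).
Proof. exact: (measurableT_comp (measurable_funP (@psd_divN R d N))
    (measurable_funP _)). Qed.

Lemma ge0_integral_scaled_wishart (Om Sg : 'M[R]_d) (f : psd R d -> \bar R) :
  measurable_fun setT f -> (forall p, 0 <= f p)%E ->
  (\int[scaled_wishart N Om Sg]_p f p =
   \int[law]_w f (psd_divN N (wishart_mx Om Sg w)))%E.
Proof.
move=> mf f0; rewrite [LHS]ge0_integral_distribution//.
rewrite [LHS]ge0_integral_distribution//; last by move=> p; exact: f0.
exact: (measurableT_comp mf (measurable_funP (@psd_divN R d N))).
Qed.

Definition noise_energy (w : T) : R := \tr (gauss_mx w *m (gauss_mx w)^T).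

Lemma noise_energyE w :
  noise_energy w = \sum_(i < d) \sum_(j < N) tnth w (mxvec_index i j) ^+ 2.
Proof.
by apply: eq_bigr => i _; rewrite mxE; apply: eq_bigr => j _; rewrite !mxE expr2.
Qed.

Lemma noise_energy_ge0 w : 0 <= noise_energy w.
Proof. exact: psdmx_trace_ge0 (psdmx_gram _). Qed.

Lemma measurable_noise_energy :
  measurable_fun setT (fun w => (noise_energy w)%:E).
Proof.
apply/measurable_EFinP; rewrite (funext noise_energyE).
apply: measurable_sum => i; apply: measurable_sum => j.
by apply: measurable_funX; exact: measurable_tnth.
Qed.

Lemma integral_noise_energy : exists2 c : R, 0 <= c &
  (\int[law]_w (noise_energy w)%:E <= c%:E)%E.
Proof.
have [c c0 cP] := @normal_prob_moment2 R.
have mt k : measurable_fun setT (fun w : T => (tnth w k ^+ 2)%:E).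
  by apply/measurable_EFinP; apply: measurable_funX; exact: measurable_tnth.
have t0 k (w : T) : (0 <= (tnth w k ^+ 2)%:E)%E by rewrite lee_fin sqr_ge0.
exists (\sum_(i < d) \sum_(j < N) c); first by do 2 apply: sumr_ge0 => ? _.
under eq_integral do rewrite noise_energyE -sumEFin.
rewrite ge0_integral_sum//; last 2 first.
- by move=> i; apply/measurable_EFinP; apply: measurable_sum => j;
    apply: measurable_funX; exact: measurable_tnth.
- by move=> i w _; rewrite lee_fin sumr_ge0// => j _; rewrite sqr_ge0.
rewrite -sumEFin; apply: lee_sum => i _.
under eq_integral do rewrite -sumEFin.
rewrite ge0_integral_sum// -sumEFin; apply: lee_sum => j _.
rewrite (ge0_integral_iid_update _ (mxvec_index i j))//.
under eq_integral => w _ do under eq_integral => x _ do rewrite tnth_update.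
by rewrite integral_cst// [X in (_ * X)%E]probability_setT mule1.
Qed.

Lemma trace_wishart_le (Om Sg : 'M[R]_d) w : (d <= N)%N -> psdmx Om -> psdmx Sg ->
  \tr (wishart_mx Om Sg w) <= 2 * \tr Om + 2 * (d%:R * \tr Sg * noise_energy w).
Proof.
move=> dN hOm hSg; apply: le_trans (trace_gramD_le _ _) _.
rewrite mean_mxP// lerD2l ler_pM2l//.
have := trace_congr_le (chol Sg) (psdmx_gram (gauss_mx w)).
by rewrite cholP// trmx_mul !mulmxA.
Qed.

Lemma trace_psd_divN_le (p : psd R d) : \tr (psd_divN N p) <= \tr (psd_mx p).
Proof.
have t0 := psdmx_trace_ge0 (psd_mxP p).
rewrite /= mxtraceZ; case: N => [|n]; first by rewrite invr0 mul0r.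
by rewrite ler_piMl// invf_le1// ler1n.
Qed.

End wishart_moments.

Section positive_definite_covariance.
Context {R : realType} {d N : nat}.
Local Notation T := ((d.+1 * N.+1).-tuple (measurableTypeR R)).
Local Notation law := (@noise_law R d.+1 N.+1).
Variable Sg : 'M[R]_d.+1.
Hypothesis hSg : posdefmx Sg.
Local Notation L := (chol Sg).

Lemma chol_unit : L \in unitmx.
Proof.
have := posdefmx_unit hSg; rewrite -{1}(cholP (posdefmx_psd hSg)).
by rewrite unitmx_mul => /andP[].
Qed.

(** Factoring L out of mean + L Z leaves L (L^-1 mean + Z), which reduces a general covariance to a
    shifted standard Gaussian matrix. *)
Definition standardized_mean (Om : 'M[R]_d.+1) : 'M[R]_(d.+1, N.+1) :=
  invmx L *m mean_mx N.+1 Om.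

Lemma wishart_mxE Om w : psd_mx (wishart_mx Om Sg w) =
  (L *m shifted_gauss_mx (standardized_mean Om) w) *m
  (L *m shifted_gauss_mx (standardized_mean Om) w)^T.
Proof.
rewrite /= /shifted_gauss_mx mulmxDr /standardized_mean mulKVmx//.
exact: chol_unit.
Qed.

Lemma lyap_wishart_le Om w :
  let W := shifted_gauss_mx (standardized_mean Om) w *m
           (shifted_gauss_mx (standardized_mean Om) w)^T in
  W \in unitmx ->
  (lyap (psd_divN N.+1 (wishart_mx Om Sg w)) <=
   (1 + \tr (wishart_mx Om Sg w) +
    N.+1%:R * (d.+1%:R * \tr ((invmx L)^T *m invmx L) * \tr (invmx W)))%:E)%E.
Proof.
move=> W Wu; have Lu := chol_unit.
have LTu : L^T \in unitmx by rewrite unitmx_tr.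
have qE : psd_mx (psd_divN N.+1 (wishart_mx Om Sg w)) =
    N.+1%:R^-1 *: (L *m W *m L^T).
  by rewrite {1}/psd_divN [LHS]/= -[X in _ *: X]/(psd_mx (wishart_mx Om Sg w))
      wishart_mxE trmx_mul !mulmxA.
have hW : psdmx W by exact: psdmx_gram.
clearbody W; have n0 : N.+1%:R != 0 :> R by rewrite pnatr_eq0.
have qu : psd_mx (psd_divN N.+1 (wishart_mx Om Sg w)) \in unitmx.
  by rewrite qE unitmxZ ?unitfE ?invr_eq0// !unitmx_mul Lu Wu LTu.
have qV : invmx (psd_mx (psd_divN N.+1 (wishart_mx Om Sg w))) =
    N.+1%:R *: ((invmx L)^T *m invmx W *m ((invmx L)^T)^T).
  rewrite -[LHS]mulmx1 -[RHS](mulKmx qu); congr (_ *m _).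
  rewrite qE -scalemxAl -scalemxAr scalerA mulVf// scale1r trmxK trmx_inv.
  by rewrite -!mulmxA (mulKVmx LTu) (mulKVmx Wu) mulmxV.
rewrite /lyap qu lee_fin lerD//; first by rewrite lerD2l trace_psd_divN_le.
rewrite qV mxtraceZ ler_pM2l ?ltr0n//.
apply: le_trans (trace_congr_le _ _) _; last by rewrite trmxK.
exact: psdmx_inv.
Qed.

(** The constant a is chosen before Om: the inverse moment is bounded uniformly in the mean, and Om
    enters only through the trace of the Gram matrix itself. *)
Lemma integral_lyap_wishart_le : (d.+3 <= N.+1)%N ->
  exists2 a : R, 0 <= a & forall Om, psdmx Om ->
    (\int[scaled_wishart N.+1 Om Sg]_p lyap p <= (a + 2 * \tr Om)%:E)%E.
Proof.
move=> dN; have dN1 : (d.+1 <= N.+1)%N by apply: leq_trans dN; rewrite ltnW.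
have hSg' := posdefmx_psd hSg; have tSg := psdmx_trace_ge0 hSg'.
have [c c0 hc] := @integral_noise_energy R d.+1 N.+1.
pose C : R := d.+1%:R * \sum_(i < d.+1) \sum_(f : {ffun 'I_d -> 'I_N.+1}) (17 *
    (17 * 17)).
have C0 : 0 <= C by rewrite mulr_ge0// sumr_ge0// => i _; rewrite sumr_ge0.
pose t := \tr ((invmx L)^T *m invmx L).
have t0 : 0 <= t.
  by rewrite /t -{2}[invmx L]trmxK; exact: psdmx_trace_ge0 (psdmx_gram _).
pose u := 2 * (d.+1%:R * \tr Sg); pose v := N.+1%:R * (d.+1%:R * t).
have u0 : 0 <= u by rewrite /u !mulr_ge0.
have v0 : 0 <= v by rewrite /v !mulr_ge0.
exists (1 + u * c + v * C); first by rewrite !addr_ge0// mulr_ge0.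
move=> Om hOm; have tOm := psdmx_trace_ge0 hOm.
rewrite ge0_integral_scaled_wishart//; last 2 first.
- exact: measurable_lyap.
- by move=> p; exact: le_trans (lyap_ge1 p).
pose mm := standardized_mean Om.
have [h [mh h0 hi hW]] := gram_inverse_trace_bound mm dN.
pose F w : \bar R := ((1 + 2 * \tr Om)%:E + (u%:E * (noise_energy w)%:E + v%:E *
    h w))%E.
have mE := @measurable_noise_energy R d.+1 N.+1.
have E0 w : (0 <= (noise_energy w)%:E :> \bar R)%E by rewrite lee_fin
    noise_energy_ge0.
have k0 : 0 <= 1 + 2 * \tr Om by rewrite addr_ge0// mulr_ge0.
apply: (@le_trans _ _ (\int[law]_w F w)%E).
  (* The comparison is only almost everywhere: [lyap] is infinite at singular matrices, where h
     gives no control. *)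
  apply: ae_ge0_le_integral => //.
  - by move=> w _; exact: le_trans (lyap_ge1 _).
  - apply: (measurableT_comp measurable_lyap); exact: measurable_scaled_wishart_mx.
  - by move=> w _; rewrite /F !adde_ge0// mule_ge0.
  - apply: emeasurable_funD => //; apply: emeasurable_funD; exact: measurable_funeM.
  exists [set w | \det (shifted_gauss_mx mm w *m (shifted_gauss_mx mm w)^T) = 0];
      split.
  - have mW : measurable_mx (fun w => shifted_gauss_mx mm w *m (shifted_gauss_mx
      mm w)^T).
      apply: measurable_mxM; first exact: measurable_shifted_gauss_mx.
      by apply: measurable_mxT; exact: measurable_shifted_gauss_mx.
    rewrite -[X in measurable X]setTI.
    exact: (measurable_det mW measurableT (measurable_set1 (0 : R))).
  - by apply: gram_nonsingular_ae.
  move=> w /=; apply: contra_notP => /eqP W0 _.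
  have Wu : shifted_gauss_mx mm w *m (shifted_gauss_mx mm w)^T \in unitmx.
    by rewrite unitmxE unitfE.
  apply: le_trans (lyap_wishart_le Wu) _; rewrite EFinD /F addeA; apply: leeD.
    rewrite -EFinM -EFinD lee_fin -addrA lerD2l /u -!mulrA.
    by have := trace_wishart_le w dN1 hOm hSg'; rewrite !mulrA.
  by rewrite mulrA EFinM; apply: lee_wpmul2l; [rewrite lee_fin|exact: hW].
have mEh : measurable_fun setT (fun w => u%:E * (noise_energy w)%:E + v%:E * h w)%E.
  by apply: emeasurable_funD; exact: measurable_funeM.
have Eh0 w : (0 <= u%:E * (noise_energy w)%:E + v%:E * h w)%E.
  by rewrite adde_ge0// mule_ge0.
rewrite /F ge0_integralD//.
rewrite integral_cst// [X in (_ * X)%E]probability_setT mule1.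
have muE : measurable_fun setT (fun w : T => u%:E * (noise_energy w)%:E)%E.
  exact: measurable_funeM.
have mvh : measurable_fun setT (fun w => v%:E * h w)%E by exact: measurable_funeM.
rewrite ge0_integralD//; [|by move=> w _; rewrite mule_ge0..].
rewrite !ge0_integralZl//.
have -> : 1 + u * c + v * C + 2 * \tr Om = (1 + 2 * \tr Om) + (u * c + v * C) by
    ring.
rewrite [leRHS]EFinD leeD2l// EFinD.
by apply: leeD; rewrite [leRHS]EFinM; apply: lee_wpmul2l; rewrite ?lee_fin.
Qed.

End positive_definite_covariance.

(** * Minorization of Wishart laws *)

Section wishart_minorization.
Context {R : realType} {d N : nat}.
Local Notation T := ((d.+1 * N.+1).-tuple (measurableTypeR R)).
Variable Sg : 'M[R]_d.+1.
Hypotheses (hSg : posdefmx Sg) (dN : (d <= N)%N).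
Local Notation L := (chol Sg).

Definition central_wishart (w : T) : psd R d.+1 :=
  psd_divN N.+1 (Psd (psdmx_gram (L *m gauss_mx w))).

Lemma measurable_central_wishart : measurable_fun setT central_wishart.
Proof.
have mG : measurable_mx (fun w : T => L *m gauss_mx w).
  apply: measurable_mxM; first exact: measurable_mx_cst.
  by move=> i j; under eq_fun do rewrite !mxE; exact: measurable_tnth.
apply: (measurableT_comp (measurable_funP (@psd_divN R d.+1 N.+1))).
by apply: measurable_psd; apply: measurable_mxM => //; exact: measurable_mxT.
Qed.

HB.instance Definition _ :=
  isMeasurableFun.Build _ _ _ _ central_wishart measurable_central_wishart.

Lemma central_wishart_shift Om w :
  psd_divN N.+1 (wishart_mx Om Sg w) =
  central_wishart [tuple translation (mxvec (standardized_mean (N := N) Sg Om) 0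
      k) (tnth w k) | k < d.+1 * N.+1].
Proof.
apply: psd_inj; set w' := mktuple _.
rewrite -[LHS]/(N.+1%:R^-1 *: psd_mx (wishart_mx Om Sg w)) wishart_mxE//.
rewrite -[RHS]/(N.+1%:R^-1 *: ((L *m gauss_mx w') *m (L *m gauss_mx w')^T)).
have -> : gauss_mx w' = shifted_gauss_mx (standardized_mean Sg Om) w; last by [].
by apply/matrixP => i j; rewrite shifted_gauss_mxE 2![LHS]mxE tnth_mktuple mxvecE.
Qed.

Lemma sum_sqr_mxvec (A : 'M[R]_(d.+1, N.+1)) :
  \sum_k mxvec A 0 k ^+ 2 = \tr (A *m A^T).
Proof.
rewrite (reindex _ (curry_mxvec_bij _ _)) /=.
rewrite [LHS](_ : _ = \sum_p mxvec A 0 (mxvec_index p.1 p.2) ^+ 2); last first.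
  by apply: eq_big => [p|[]].
rewrite -(pair_bigA _ (fun i j => mxvec A 0 (mxvec_index i j) ^+ 2))/=.
apply: eq_bigr => i _; rewrite mxE; apply: eq_bigr => j _.
by rewrite mxvecE !mxE expr2.
Qed.

(** nu is the scaled central Wishart law with covariance Sg / 2, the image of Gaussian variables of
    variance 1/2; the mean affects only eps, the product over all entries of the constants of
    [normal_prob_shift_ge]. *)
Lemma wishart_minorization : exists nu : probability (psd R d.+1) R,
  forall l : R, exists2 eps : R, 0 < eps &
    forall Om, psdmx Om -> \tr Om <= l -> forall U, measurable U ->
      (eps%:E * nu U <= scaled_wishart N.+1 Om Sg U)%E.
Proof.
pose Q := iid (normal_prob (0 : R) (Num.sqrt 2)^-1) (d.+1 * N.+1).
exists (distribution Q central_wishart) => l.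
(* The squared shifts add up to the squared norm of the standardized mean, the trace of L^-1 Om
   (L^-1)', which c bounds when Om has trace at most l. *)
pose c := d.+1%:R * \tr (invmx L *m (invmx L)^T) * l.
exists (expR (- c) / Num.sqrt 2 ^+ (d.+1 * N.+1)).
  by rewrite divr_gt0 ?expR_gt0 ?exprn_gt0 ?sqrtr_gt0.
move=> Om hOm Oml U mU; pose mv k := mxvec (standardized_mean (N := N) Sg Om) 0 k.
pose f w : \bar R := (\1_U (central_wishart w))%:E.
have mf : measurable_fun setT f.
  apply: (@measurableT_comp _ _ _ _ _ _ (fun p : psd R d.+1 => (\1_U p)%:E)).
    by apply/measurable_EFinP; exact: measurable_indic.
  exact: measurable_central_wishart.
have f0 w : (0 <= f w)%E by rewrite lee_fin.
have swE : scaled_wishart N.+1 Om Sg U = (\int[@noise_law R d.+1 N.+1]_w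
    f [tuple translation (mv k) (tnth w k) | k < d.+1 * N.+1])%E.
  rewrite -[in LHS](setIT U) -[LHS]integral_indic// ge0_integral_scaled_wishart//.
    by apply: eq_integral => w _; rewrite /f /mv -central_wishart_shift.
  by apply/measurable_EFinP; exact: measurable_indic.
have QE : distribution Q central_wishart U = (\int[Q]_w f w)%E.
  transitivity (\int[distribution Q central_wishart]_p (\1_U p)%:E)%E.
    by rewrite integral_indic// setIT.
  rewrite [LHS]ge0_integral_distribution.
  - by apply: eq_integral.
  - by apply/measurable_EFinP; exact: measurable_indic.
  - by move=> p; rewrite lee_fin.
have e0 k : 0 <= expR (- mv k ^+ 2) / Num.sqrt 2 by rewrite divr_ge0 ?expR_ge0.
rewrite [X in (_ * X <= _)%E]QE [leRHS]swE;
    apply: le_trans (@ge0_le_integral_iid _ _ _ (normal_prob (0 : R) 1)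
    (normal_prob (0 : R) (Num.sqrt 2)^-1)
  _ (fun k => translation (mv k)) (fun k => expR (- mv k ^+ 2) / Num.sqrt 2)
  f (fun k => measurable_translation (mv k)) e0 (fun k => @normal_prob_shift_ge _
      (mv k)) mf f0).
apply: lee_wpmul2r.
  exact: integral_ge0.
rewrite lee_fin prodf_div -expR_sum prodr_const card_ord ler_pM2r; last first.
  by rewrite invr_gt0 exprn_gt0// sqrtr_gt0.
rewrite ler_expR sumrN lerN2 sum_sqr_mxvec /standardized_mean.
have mmP : mean_mx N.+1 Om *m (mean_mx N.+1 Om)^T = Om by exact: mean_mxP.
move: (mean_mx N.+1 Om) mmP => mm mmP.
rewrite trmx_mul mulmxA -(mulmxA (invmx L)) mmP.
apply: le_trans (trace_congr_le _ hOm) _; rewrite /c.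
by apply: ler_wpM2l => //; rewrite mulr_ge0//;
    exact: psdmx_trace_ge0 (psdmx_gram _).
Qed.

End wishart_minorization.

(** * The ensemble Kalman filter *)

Section enkf_bounds.
Context {R : realType} {d d0 N : nat}.
Variables (A : 'M[R]_d.+1) (B : 'M[R]_(d0, d.+1)) (R1 : 'M[R]_d.+1) (R0 : 'M[R]_d0).
Hypotheses (hR1 : posdefmx R1) (hR0 : posdefmx R0)
  (hS : posdefmx (B^T *m invmx R0 *m B)) (dN : (d.+3 <= N.+1)%N).
Local Notation update :=
  (wishart_kernel N.+1 (measurable_update_mean B R0 N.+1) (measurable_update_cov
      B R0)).
Local Notation predict :=
  (wishart_kernel N.+1 (measurable_predict_mean A N.+1) (measurable_predict_cov
      R1)).
Local Notation enkf := (enkf_transition A B R1 R0 N.+1).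

Lemma integral_update_trace : exists2 c : R, 0 <= c &
  forall p, (\int[update p]_q (\tr (psd_mx q))%:E <= c%:E)%E.
Proof.
have [c c0 hc] := @integral_noise_energy R d.+1 N.+1.
(* By [trace_update_le], s bounds the traces of both the mean part, before its factor N, and the
   covariance of the update, for every p. *)
pose s := \tr (invmx (B^T *m invmx R0 *m B)).
have s0 : 0 <= s.
  by apply/psdmx_trace_ge0/psdmx_inv; [exact: posdefmx_psd|exact: posdefmx_unit].
exists (2 * s + 2 * (d.+1%:R * s) * c); first by rewrite addr_ge0 ?mulr_ge0.
move=> p; have hp := psd_mxP p.
have hm : psdmx (Ahat B R0 p *m p *m (Ahat B R0 p)^T) by exact: psdmx_congr.
have hOm : psdmx (update_mean B R0 N.+1 p) by exact: psdmxZ.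
have hSg : psdmx (update_cov B R0 p) by apply: psdmx_congr; exact: posdefmx_psd.
have := trace_update_le hR0 hS hp; rewrite -/s => hs.
have tm := psdmx_trace_ge0 hm; have tR := psdmx_trace_ge0 hSg.
rewrite ge0_integral_scaled_wishart; last 2 first.
- exact: measurable_psd_trace.
- by move=> q; rewrite lee_fin; exact: psdmx_trace_ge0 (psd_mxP q).
have mE := @measurable_noise_energy R d.+1 N.+1.
have E0 w : (0 <= (noise_energy w)%:E :> \bar R)%E by rewrite lee_fin
    noise_energy_ge0.
have k0 : 0 <= 2 * s by rewrite mulr_ge0.
have k1 : 0 <= 2 * (d.+1%:R * s) by rewrite !mulr_ge0.
pose F (w : (d.+1 * N.+1).-tuple (measurableTypeR R)) : \bar R :=
  ((2 * s)%:E + (2 * (d.+1%:R * s))%:E * (noise_energy w)%:E)%E.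
apply: (@le_trans _ _ (\int[@noise_law R d.+1 N.+1]_w F w)%E).
  apply: ge0_le_integral => //.
  - by move=> w _; rewrite lee_fin; exact: psdmx_trace_ge0 (psd_mxP _).
  - apply: (measurableT_comp measurable_psd_trace);
      exact: measurable_scaled_wishart_mx.
  - by apply: emeasurable_funD => //; exact: measurable_funeM.
  move=> w _; rewrite /F -EFinM -EFinD lee_fin.
  rewrite (_ : \tr _ = N.+1%:R^-1 *
    \tr (wishart_mx (update_mean B R0 N.+1 p) (update_cov B R0 p) w)); last first.
    exact: mxtraceZ.
  have := trace_wishart_le w (leq_trans (leqnSn _) (leq_trans (leqnSn _) dN)) hOm
      hSg.
  have -> : \tr (update_mean B R0 N.+1 p) =
      N.+1%:R * \tr (Ahat B R0 p *m p *m (Ahat B R0 p)^T) by exact: mxtraceZ.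
  have ninv0 : 0 <= N.+1%:R^-1 :> R by rewrite invr_ge0.
  have ninv1 : N.+1%:R^-1 <= 1 :> R by rewrite invf_le1// ler1n.
  move=> /(ler_wpM2l ninv0)/le_trans; apply.
  have n0 : N.+1%:R != 0 :> R by rewrite pnatr_eq0.
  have w0 := noise_energy_ge0 w; move: hs tm tR w0.
  rewrite -/(update_cov B R0 p).
  set x := \tr _; set y := \tr _; set e := noise_energy w => hs tm tR w0.
  (* The factor N of the mean cancels against the scaling; for the noise part 1 / N <= 1 is
     enough. *)
  have -> : N.+1%:R^-1 * (2 * (N.+1%:R * x) + 2 * (d.+1%:R * y * e)) =
      2 * x + N.+1%:R^-1 * (2 * (d.+1%:R * y) * e) by field.
  apply: lerD; first by rewrite ler_pM2l//; lra.
  apply: (@le_trans _ _ (2 * (d.+1%:R * y) * e)).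
    by rewrite ler_piMl// !mulr_ge0.
  by apply: ler_wpM2r => //; rewrite ler_pM2l// ler_wpM2l//; lra.
rewrite /F ge0_integralD//; [|by move=> w _;
    rewrite mule_ge0..|exact: measurable_funeM].
rewrite integral_cst// [X in (_ * X)%E]probability_setT mule1.
rewrite ge0_integralZl// EFinD; apply: leeD => //.
by rewrite [leRHS]EFinM; apply: lee_wpmul2l.
Qed.

Lemma integral_predict_lyap : exists ab : R * R, [/\ 0 <= ab.1, 0 <= ab.2 &
  forall p, (\int[predict p]_q lyap q <= (ab.1 + ab.2 * \tr (psd_mx p))%:E)%E].
Proof.
have [a a0 ha] := integral_lyap_wishart_le hR1 dN.
exists (a, 2 * (N.+1%:R * (d.+1%:R * \tr (A *m A^T)))); split => //=.
  by rewrite !mulr_ge0//; exact: psdmx_trace_ge0 (psdmx_gram _).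
move=> p; have hOm : psdmx (predict_mean A N.+1 p).
  by apply: psdmxZ => //; apply: psdmx_congr; exact: psd_mxP.
apply: le_trans (ha _ hOm) _; rewrite lee_fin lerD2l -mulrA ler_pM2l//.
rewrite [leLHS]mxtraceZ -mulrA ler_pM2l ?ltr0n//.
by apply: trace_congr_le; exact: psd_mxP.
Qed.

Lemma ge0_integral_enkf (p : psd R d.+1) (f : psd R d.+1 -> \bar R) :
  measurable_fun setT f -> (forall q, 0 <= f q)%E ->
  (\int[enkf p]_q f q = \int[update p]_y \int[predict y]_q f q)%E.
Proof. by move=> mf f0; exact: ge0_integral_mixture. Qed.

Lemma integral_enkf_lyap : exists c : R, forall p,
  (\int[enkf p]_q lyap q <= c%:E)%E.
Proof.
have [c c0 hc] := integral_update_trace.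
have [[a b] /= [a0 b0 hab]] := integral_predict_lyap.
exists (a + b * c) => p.
have l0 q : (0 <= @lyap R d.+1 q)%E by exact: le_trans (lyap_ge1 q).
have t0 (y : psd R d.+1) : 0 <= \tr (psd_mx y) by exact: psdmx_trace_ge0 (psd_mxP
    y).
have mt := @measurable_psd_trace R d.+1.
have mb : measurable_fun setT (fun y : psd R d.+1 => b%:E * (\tr (psd_mx y))%:E)%E.
  exact: measurable_funeM.
rewrite ge0_integral_enkf//; last exact: measurable_lyap.
apply: (@le_trans _ _ (\int[update p]_y (a%:E + b%:E * (\tr (psd_mx y))%:E))%E).
  apply: ge0_le_integral => //.
  - by move=> y _; exact: integral_ge0.
  - apply: measurable_fun_integral_kernel => //; last exact: measurable_lyap.
    exact: measurable_kernel.
  - exact: emeasurable_funD.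
  by move=> y _; rewrite -EFinM -EFinD; exact: hab.
rewrite ge0_integralD//; last by move=> y _; rewrite mule_ge0// lee_fin.
rewrite integral_cst// prob_kernel mule1 ge0_integralZl//; last first.
  by move=> y _; rewrite lee_fin.
rewrite [leRHS]EFinD [X in (_ <= _ + X)%E]EFinM; apply: leeD => //.
by apply: lee_wpmul2l.
Qed.

Lemma enkf_minorization : exists nu : probability (psd R d.+1) R,
  exists2 eps : R, 0 < eps < 1 &
    forall p U, measurable U -> (eps%:E * nu U <= enkf p U)%E.
Proof.
have [c c0 hc] := integral_update_trace.
have dN' : (d <= N)%N by rewrite -ltnS; apply: leq_trans dN;
    rewrite -addn2 leq_addr.
have [nu hnu] := wishart_minorization hR1 dN'.
(* Markov's inequality bounds the mass outside D by c / l < 1/2; the added 1 keeps l positive when c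
   = 0. *)
pose l : R := 2 * c + 1.
have l0 : 0 < l by rewrite /l; lra.
(* The argument of [hnu] bounds the trace of the prediction mean over D. *)
have [eps eps0 heps] := hnu (N.+1%:R * (d.+1%:R * \tr (A *m A^T) * l)).
(* The factor 1/2 is the lower bound on the mass of D; the minimum with 1 ensures e < 1. *)
pose e := Num.min eps 1 / 2.
have e0 : 0 < e by rewrite divr_gt0// lt_min eps0 ltr01.
have e1 : e < 1 by rewrite ltr_pdivrMr// mul1r gt_min; apply/orP; right; lra.
exists nu, e; first by rewrite e0 e1.
move=> p U mU.
pose D := [set y : psd R d.+1 | \tr (psd_mx y) <= l].
have t0 (y : psd R d.+1) : 0 <= \tr (psd_mx y) by exact: psdmx_trace_ge0 (psd_mxP
    y).
have mt := @measurable_psd_trace R d.+1.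
have mD : measurable D.
  rewrite (_ : D = [set: psd R d.+1] `&` [set y | ((\tr (psd_mx y))%:E <= l%:E)%E]).
    exact: emeasurable_fun_infty_c.
  by rewrite setTI; apply/seteqP; split => y /=; rewrite lee_fin.
have half : (2^-1%:E <= update p D)%E.
  have : (l%:E * update p (~` D) <= c%:E)%E.
    apply: le_trans (hc p); rewrite -integral_cst; last exact: measurableC.
    rewrite integral_mkcond; apply: ge0_le_integral => //.
    - by move=> y _; rewrite patchE; case: ifP => // _; rewrite lee_fin ltW.
    - by apply/(measurable_restrictT _ (measurableC mD)).
    move=> y _; rewrite patchE; case: ifPn => [|_]; last by rewrite lee_fin.
    by rewrite inE/= => /negP; rewrite -ltNge lee_fin => /ltW.
  have : (update p D + update p (~` D) = 1)%E.
    rewrite -measureU ?setICr//; last exact: measurableC.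
    by rewrite setUv; exact: prob_kernel.
  have := measure_ge0 (update p) D; have := measure_ge0 (update p) (~` D).
  move: (update p D) (update p (~` D)) => [x| |] [y| |]//.
  rewrite -EFinM -EFinD !lee_fin => y0 x0 [xy] ly.
  rewrite /l in ly; nra.
have geD (y : psd R d.+1) : D y -> (eps%:E * nu U <= predict y U)%E.
  move=> Dy; apply: heps => //.
    by apply: psdmxZ => //; apply: psdmx_congr; exact: psd_mxP.
  rewrite [leLHS]mxtraceZ ler_pM2l ?ltr0n//.
  apply: le_trans (trace_congr_le _ (psd_mxP y)) _.
  by apply: ler_wpM2l => //; rewrite mulr_ge0//;
      exact: psdmx_trace_ge0 (psdmx_gram _).
have nu0 : (0 <= eps%:E * nu U)%E by rewrite mule_ge0// lee_fin ltW.
apply: (@le_trans _ _ (eps%:E * nu U * update p D)%E).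
  apply: (@le_trans _ _ (eps%:E * nu U * 2^-1%:E)%E); last exact: lee_wpmul2l.
  rewrite muleAC -EFinM; apply: lee_wpmul2r => //; rewrite lee_fin.
  by rewrite ler_pM2r// ge_min lexx.
rewrite -integral_cst// integral_mkcond.
apply: (@ge0_le_integral _ _ _ (update p)) => //.
- by move=> y _; rewrite patchE; case: ifP.
- by apply/(measurable_restrictT _ mD).
- exact: measurable_kernel.
by move=> y _; rewrite patchE; case: ifPn => [/set_mem|_];
    [exact: geD|exact: measure_ge0].
Qed.

End enkf_bounds.

Theorem theorem5p5 (R : realType) (d d0 N : nat)
    (A : 'M[R]_d) (B : 'M[R]_(d0, d)) (R1 : 'M[R]_d) (R0 : 'M[R]_d0)
    (hd : (1 <= d)%N) (hd0 : (1 <= d0)%N)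
    (hR1 : posdefmx R1) (hR0 : posdefmx R0)
    (hS : posdefmx (B^T *m invmx R0 *m B))
    (hN : (2 * d + 1 <= N)%N) :
  let T := enkf_transition A B R1 R0 N in
  (exists pi : probability (psd R d) R,
    [/\ prob_lyap pi, is_invariant T pi
      & forall pi' : probability (psd R d) R,
          prob_lyap pi' -> is_invariant T pi' ->
          forall U : set (psd R d), measurable U -> pi' U = pi U]) /\
  (exists a b : R,
    [/\ 0 < a, 0 < b
      & forall (n : nat) (mu1 mu2 : probability (psd R d) R),
          (1 <= n)%N -> prob_lyap mu1 -> prob_lyap mu2 ->
          let Tn := markov_iter T n in
          (wnorm (signed_diff (markov_act mu1 Tn) (markov_act mu2 Tn)) lyap
             <= (a * expR (- (b * n%:R)))%:E
                * wnorm (signed_diff mu1 mu2) lyap)%E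
          /\
          (tv_norm (signed_diff (markov_act mu1 Tn) (markov_act mu2 Tn))
             <= (a * expR (- (b * n%:R)))%:E
                * tv_norm (signed_diff mu1 mu2))%E]).
Proof.
(* 2 d + 1 >= d + 2 because d >= 1. With d = d' + 1 and N = N' + 1 this reads d' + 3 <= N' + 1, the
   form in which the Gaussian bounds are stated. *)
move=> T; have dN : (d.+2 <= N)%N.
  by apply: leq_trans hN; rewrite mul2n -addnn -addnA -addn2 leq_add2l -addn1 leq_add2r.
case: d A B R1 hd hR1 hS {hN} dN @T => [//|d'] A' B' R1' _ hR1' hS' dN.
case: N dN => [//|N'] dN T.
have [c hc] := integral_enkf_lyap A' hR1' hR0 hS' dN.
have [nu [eps eps01 minor]] := enkf_minorization A' hR1' hR0 hS' dN.
have [[pi [Vpi ipi upi]] [a [b [a0 b0 hab]]]] :=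
  doeblin_weighted_ergodicity eps01 minor measurable_lyap lyap_ge1 hc.
split; first by exists pi; split => // pi' _; exact: upi.
by exists a, b; split => // n mu1 mu2 n1 _ _; exact: hab.
Qed.
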